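(* Let $\mathcal V,\mathcal W\subset\mathcal H$ be finite dimensional subspaces with $\mathcal V\oplus\mathcal W^\perp=\mathcal H$, $d=\dim\mathcal V=\dim\mathcal W$, let $0\le\theta_1\le\dots\le\theta_d<\pi/2$ be the principal angles between $\mathcal V$ and $\mathcal W$, and let $\{w_j\}_{j\in\mathbb I_d}$ be an orthonormal basis of $\mathcal W$ of principal vectors between $\mathcal V$ and $\mathcal W$. Let $\mathcal F=\{f_i\}_{i\in\mathbb I_n}$ be a frame for $\mathcal W$ with $\lambda(S_{\mathcal F})=(\lambda_i)_{i\in\mathbb M}$, and let $\{x_j\}_{j\in\mathbb I_d}$ be an orthonormal basis of $\mathcal W$ such that $S_{\mathcal F}x_j=\lambda_jx_j$ for every $j\in\mathbb I_d$. 1. Let $U_0\in B(\mathcal H)$ be a unitary operator such that $U_0x_j=w_{d-j+1}$ for every $j\in\mathbb I_d$. Then $$\lambda\big(S_{(U_0\cdot\mathcal F)^\#_{\mathcal V}}\big)=\Big(\big(\cos^{-2}(\theta_j)\,\lambda_{d-j+1}^{-1}\big)_{j\in\mathbb I_d}^{\downarrow}\,,\,0_{|\mathbb M|-d}\Big).$$ 2. With $U_0$ as in item 1, if $h\in\mathrm{Conv}(\mathbb R_{\ge0})$ is non-decreasing then $$P_h\big((U_0\cdot\mathcal F)^\#_{\mathcal V}\big)=\min\{P_h\big((U\cdot\mathcal F)^\#_{\mathcal V}\big):\ U\in B(\mathcal H)\text{ unitary},\ U(\mathcal W)=\mathcal W\}.\qquad( * )$$ Moreover, if in addition $h$ is strictly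 convex (and non-decreasing) and $U$ is a unitary operator with $U(\mathcal W)=\mathcal W$ such that $U\cdot\mathcal F$ attains the minimum in $( * )$, then there exist an orthonormal basis $\{w'_j\}_{j\in\mathbb I_d}$ of $\mathcal W$ of principal vectors between $\mathcal V$ and $\mathcal W$ and an orthonormal basis $\{x'_j\}_{j\in\mathbb I_d}$ of $\mathcal W$ such that $S_{\mathcal F}x'_j=\lambda_jx'_j$ and $Ux'_j=w'_{d-j+1}$ for every $j\in\mathbb I_d$.
   Context: $\mathcal H$ is a complex separable Hilbert space; $\mathbb I_k=\{1,\dots,k\}$; $\mathbb M=\mathbb I_p$ if $\dim\mathcal H=p<\infty$ and $\mathbb M=\mathbb N$ if $\dim\mathcal H=\infty$. $\mathcal V\oplus\mathcal W^\perp=\mathcal H$ means $\mathcal V+\mathcal W^\perp=\mathcal H$ and $\mathcal V\cap\mathcal W^\perp=\{0\}$. $P_{\mathcal V}$ is the orthogonal projection onto $\mathcal V$, $P_{\mathcal V//\mathcal W^\perp}$ is the oblique projection with range $\mathcal V$ and null space $\mathcal W^\perp$, and $|T|=(T^*T)^{1/2}$. For $z\in\mathbb R^d$, $z^\downarrow$ is its non-increasing rearrangement. Principal angles: $0\le\theta_1\le\dots\le\theta_d\le\pi/2$ are such that the $d$ largest singular values of $P_{\mathcal W}P_{\mathcal V}$, in non-increasing order, are $\cos\theta_1,\dots,\cos\theta_d$; here $\theta_d<\pi/2$. An orthonormal basis $\{w_j\}_{j\in\mathbb I_d}$ of $\mathcal W$ consists of principal vectors between $\mathcal V$ and $\mathcal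 W$ if $|P_{\mathcal V}P_{\mathcal W}|w_j=\cos(\theta_j)w_j$ for every $j\in\mathbb I_d$. For a finite sequence $\mathcal F=\{f_i\}_{i\in\mathbb I_n}$ in $\mathcal H$, $T_{\mathcal F}(a)=\sum_i a_if_i$, $S_{\mathcal F}=T_{\mathcal F}T_{\mathcal F}^*$ is the frame operator, and $U\cdot\mathcal F=\{Uf_i\}_{i\in\mathbb I_n}$. A finite sequence in $\mathcal W$ is a frame for $\mathcal W$ iff it spans $\mathcal W$. The canonical $\mathcal V$-dual of a frame $\mathcal F$ for $\mathcal W$ is $\mathcal F^\#_{\mathcal V}=\{P_{\mathcal V//\mathcal W^\perp}S_{\mathcal F}^\dagger f_i\}_{i\in\mathbb I_n}$ ($\dagger$ = Moore-Penrose pseudo-inverse). For a finite sequence $\mathcal G$, $\lambda(S_{\mathcal G})=(\lambda_i(S_{\mathcal G}))_{i\in\mathbb M}$ is the list of positive eigenvalues of $S_{\mathcal G}$ (with multiplicity, non-increasing) followed by zeros. $\mathrm{Conv}(\mathbb R_{\ge0})$ is the set of convex functions $h:[0,\infty)\to[0,\infty)$. For such $h$ and a finite sequence $\mathcal G$ whose span has dimension $r$, $P_h(\mathcal G)=\sum_{i=1}^rh(\lambda_i(S_{\mathcal G}))$. *)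

(* Defs.v *)
From HB Require Import structures.
From mathcomp Require Import all_boot all_order all_algebra.
From mathcomp Require Import complex.
From mathcomp Require Import all_classical all_reals all_analysis.

Set Implicit Arguments.
Unset Strict Implicit.
Unset Printing Implicit Defensive.

Import Order.TTheory GRing.Theory Num.Theory.
Import numFieldNormedType.Exports.

Local Open Scope classical_set_scope.
Local Open Scope complex_scope.
Local Open Scope ring_scope.

(* The inner product is linear in its first argument and conjugate-linear in
   its second one. *)
HB.mixin Record isHilbert (R : realType) H & CompleteNormedModule R[i] H := {
  inner : {dot H for Num.conj};
  inner_norm : forall x : H, inner x x = `|x| ^+ 2
}.

#[short(type="hilbertType")]
HB.structure Definition Hilbert (R : realType) :=
  {H of CompleteNormedModule R[i] H & isHilbert R H}.

Notation "''[' x , y ]" := (inner x y) : ring_scope.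

Definition separable (T : topologicalType) : Prop :=
  exists2 A : set T, countable A & dense A.

Section Subspaces.
Variables (R : realType) (H : hilbertType R).
Implicit Types V W Z : set H.

Definition synthesis n (F : 'I_n -> H) (a : 'I_n -> R[i]) : H :=
  \sum_(i < n) a i *: F i.

Definition lspan n (F : 'I_n -> H) : set H := range (synthesis F).

Definition lin_indep n (F : 'I_n -> H) : Prop :=
  forall a, synthesis F a = 0 -> forall i, a i = 0.

Definition has_dim V (d : nat) : Prop :=
  exists2 e : 'I_d -> H, lin_indep e & lspan e = V.

Definition sdim V : nat := get (has_dim V).

Definition orthonormal_basis V d (e : 'I_d -> H) : Prop :=
  (forall i j, '[e i, e j] = (i == j)%:R) /\ lspan e = V.

Definition orthocompl W : set H :=
  [set x | forall w, W w -> '[x, w] = 0].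

Definition direct_sum V Z : Prop :=
  [set v + z | v in V & z in Z] = setT /\ V `&` Z = [set 0].

End Subspaces.

Section Operators.
Variables (R : realType) (H : hilbertType R).
Implicit Types (V W Z : set H) (A B S T X : H -> H).

(* The operators below are selected by their defining property, which
   determines them uniquely; when no such operator exists, get returns an
   irrelevant default. *)
Definition is_oblique_proj V Z T : Prop :=
  [/\ linear T, T \o T = T, range T = V & T @^-1` [set 0] = Z].

Definition oblique_proj V Z : H -> H := get (is_oblique_proj V Z).

Definition orth_proj V : H -> H := oblique_proj V (orthocompl V).

Definition is_adjoint A B : Prop :=
  linear B /\ forall x y, '[A x, y] = '[x, B y].

Definition adjoint A : H -> H := get (is_adjoint A).

Definition positive_op A : Prop := linear A /\ forall x, 0 <= '[A x, x].

Definition is_modulus T A : Prop :=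
  positive_op A /\ A \o A = adjoint T \o T.

Definition modulus T : H -> H := get (is_modulus T).

Definition is_pinv S X : Prop :=
  [/\ linear X, S \o X \o S = S, X \o S \o X = X,
      is_adjoint (S \o X) (S \o X) & is_adjoint (X \o S) (X \o S)].

Definition pinv S : H -> H := get (is_pinv S).

Definition unitary (U : {linear H -> H}) : Prop :=
  continuous U /\
  exists B, [/\ is_adjoint U B, B \o U = idfun & U \o B = idfun].

Definition eigenspace A (mu : R) : set H := [set x | A x = mu%:C *: x].

Definition is_pos_eigenvalues A (s : seq R) : Prop :=
  [/\ sorted >=%R s, {in s, forall mu, 0 < mu} &
      forall mu, 0 < mu -> has_dim (eigenspace A mu) (count_mem mu s)].

(* The positive eigenvalues of A, repeated according to multiplicity and in
   non-increasing order, followed by zeros (the default value of `_i).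
   The zeros continue past index dim H when H is finite-dimensional, so that
   all these sequences have the common index set nat; indices start at 0. *)
Definition eigenvalues A (i : nat) : R := (xget [::] (is_pos_eigenvalues A))`_i.

Definition singular_values T : nat -> R := eigenvalues (modulus T).

End Operators.

Section PrincipalAngles.
Variables (R : realType) (H : hilbertType R) (V W : set H) (d : nat).

Definition principal_angles (theta : 'I_d -> R) : Prop :=
  [/\ forall j, 0 <= theta j <= pi / 2,
      {homo theta : i j / (i <= j)%N >-> i <= j} &
      forall j : 'I_d, singular_values (orth_proj W \o orth_proj V) j = cos (theta j)].

Definition principal_vectors (theta : 'I_d -> R) (w : 'I_d -> H) : Prop :=
  orthonormal_basis W w /\
  forall j, modulus (orth_proj V \o orth_proj W) (w j) =
            (cos (theta j))%:C *: w j.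

End PrincipalAngles.

Section Frames.
Variables (R : realType) (H : hilbertType R) (n : nat).
Implicit Types F G : 'I_n -> H.

Definition analysis F (x : H) : 'I_n -> R[i] := fun i => '[x, F i].

Lemma analysis_adjoint F a x :
  '[synthesis F a, x] = \sum_(i < n) a i * Num.conj (analysis F x i).
Proof.
rewrite /synthesis linear_sumlz; apply: eq_bigr => i _.
rewrite linearZl_LR /=; congr (_ * _).
by rewrite /analysis (hermitian_subproof x (F i)) expr0 mul1r conjCK.
Qed.

(* synthesis F composed with its adjoint, by analysis_adjoint *)
Definition frame_op F : H -> H := synthesis F \o analysis F.

Definition is_frame (W : set H) F : Prop := lspan F = W.

Definition canonical_dual (V W : set H) F : 'I_n -> H :=
  oblique_proj V (orthocompl W) \o pinv (frame_op F) \o F.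

Definition potential (h : R -> R) G : R :=
  \sum_(i < sdim (lspan G)) h (eigenvalues (frame_op G) i).

End Frames.

Section ConvexFunctions.
Variable R : realType.
Implicit Type h : R -> R.

(* Functions on [0, +oo) are represented by total functions whose values at
   negative arguments are irrelevant. *)
Definition Conv_ge0 h : Prop :=
  (forall x, 0 <= x -> 0 <= h x) /\ convex_function (`[0, +oo[ : set R) h.

Definition nondecreasing_ge0 h : Prop :=
  forall x y, 0 <= x -> x <= y -> h x <= h y.

Definition strictly_convex_ge0 h : Prop :=
  forall x y t, 0 <= x -> 0 <= y -> x != y -> 0 < t -> t < 1 ->
  h (t * x + (1 - t) * y) < t * h x + (1 - t) * h y.

Definition decreasing_rearrangement d (z : 'I_d -> R) : seq R :=
  sort >=%R [seq z j | j <- enum 'I_d].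

Definition is_min (A : set R) (m : R) : Prop := A m /\ lbound A m.

End ConvexFunctions.

Definition dual_potentials (R : realType) (H : hilbertType R) (V W : set H) n
    (F : 'I_n -> H) (h : R -> R) : set R :=
  [set potential h (canonical_dual V W (U \o F)) |
    U in [set U : {linear H -> H} | unitary U /\ U @` W = W]].

(* Main.v *)
(** The dual of [U . F] has frame operator [sum_j lam_j^-1 <., Q y_j> Q y_j],
    with [Q] the oblique projection and [y_j = U x_j], and [Q* Q] has
    eigenvectors [w_j] and eigenvalues [a_j = cos^-2 theta_j] on [W]. Its
    eigenvalues [mu] are thus those of a product of two positive operators [A]
    and [B] on [W], with spectra [a] (increasing) and [b] (decreasing), and the
    claim is that [a b] is weakly majorized by [mu].
    Following Li and Mathias, one truncates: replacing [mu] by [max mu t]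
    replaces [B] by an operator above both [B] and [t A^-1], so that by
    monotonicity of eigenvalues its spectrum is at least [max (a b) t / a]; the
    trace inequality for oppositely ordered spectra then gives
    [sum max (a b) t <= sum max mu t] for every [t >= 0].
    If [h] is strictly convex, a minimizer has [mu = a b] up to order, so
    [tr A B = sum a b], and comparing the sums of squares of the eigenvalues
    shows that the ordered eigenbasis of [A - B] diagonalizes both operators
    in opposite orders. *)
Require Import Defs.
From mathcomp Require Import all_boot all_order all_algebra perm spectral sesquilinear.
From mathcomp Require Import complex.
From mathcomp Require Import all_classical all_reals all_analysis.
From mathcomp Require Import ring lra.
Set Implicit Arguments.
Unset Strict Implicit.
Unset Printing Implicit Defensive.
Import Order.TTheory GRing.Theory Num.Theory.
Import numFieldNormedType.Exports.
Local Open Scope classical_set_scope.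
Local Open Scope complex_scope.
Local Open Scope ring_scope.

(** * Majorization and doubly stochastic matrices *)

Section Majorization.
Variable R : realType.

Definition antitone d (f : 'I_d -> R) := forall i j : 'I_d, (i <= j)%N -> f j <= f i.

Definition doubly_stochastic d (p : 'I_d -> 'I_d -> R) :=
  [/\ forall k l, 0 <= p k l, forall k, \sum_l p k l = 1 &
      forall l, \sum_k p k l = 1].

(** Summation by parts in inductive form: as the total of [x] is nonnegative, [c] may be raised to
    the last value of [s]. The last terms then cancel, and that value is the lower bound for the
    shorter family. *)
Lemma abel_sum_ge d (s x : 'I_d -> R) (c : R) :
  antitone s -> (forall i, c <= s i) ->
  (forall m, 0 <= \sum_(k < d | (k < m)%N) x k) ->
  c * \sum_k x k <= \sum_k s k * x k.
Proof.
elim: d s x c => [|d IH] s x c anti cle heads; first by rewrite !big_ord0 mulr0.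
have total : 0 <= \sum_k x k.
  by apply: le_trans (heads d.+1) _; rewrite (eq_bigl xpredT) // => k; rewrite ltn_ord.
apply: (le_trans (ler_wpM2r total (cle ord_max))).
rewrite !big_ord_recr mulrDr lerD2r; apply: IH => [i j ij|i|m].
- exact: anti.
- by apply: anti; rewrite -ltnS; exact: ltn_ord.
(* Cutting at [minn m d] keeps the last index out of the head, whatever [m] is. *)
- apply: le_trans (heads (minn m d)) _.
  rewrite big_mkcond big_ord_recr /= [X in _ + X]ifF ?addr0.
    rewrite -big_mkcond /=; rewrite le_eqVlt; apply/predU1P; left; apply: eq_bigl => k.
    by rewrite ltn_min /= ltn_ord andbT.
  by rewrite ltn_min ltnn andbF.
Qed.

(** The two alternatives correspond to weak and to full majorization. In the second, the lower bound
    of [s] multiplies a zero total and may have any sign. *)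
Lemma abel_sum_ge0 d (s x : 'I_d -> R) :
  antitone s -> (forall m, 0 <= \sum_(k < d | (k < m)%N) x k) ->
  (forall i, 0 <= s i) \/ \sum_k x k = 0 ->
  0 <= \sum_k s k * x k.
Proof.
move=> anti heads [s0|x0].
  by have := abel_sum_ge anti s0 heads; rewrite mul0r.
case: d s x anti heads x0 => [|d] s x anti heads x0; first by rewrite big_ord0.
have := @abel_sum_ge _ s x (s ord_max) anti _ heads; rewrite x0 mulr0; apply => i.
by apply: anti; rewrite -ltnS; exact: ltn_ord.
Qed.

(** [t] is the value at index [m], or [c] when the head exhausts the family. *)
Lemma antitone_threshold d (f : 'I_d -> R) (c : R) (m : nat) :
  antitone f -> (forall i, c <= f i) ->
  exists2 t, c <= t & forall k : 'I_d, if (k < m)%N then t <= f k else f k <= t.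
Proof.
move=> anti cle; case: (ltnP m d) => md.
  exists (f (Ordinal md)) => // k; case: ltnP => km; apply: anti => //=.
  exact: ltnW.
by exists c => // k; rewrite (leq_trans (ltn_ord k) md).
Qed.

Lemma antitone_lbound d (f : 'I_d -> R) : antitone f -> exists c, forall i, c <= f i.
Proof.
case: d f => [|d] f anti; first by exists 0; case.
by exists (f ord_max) => i; apply: anti; rewrite -ltnS; exact: ltn_ord.
Qed.

(** The column sums [q] over the first [m] rows lie between 0 and 1 and have the same total as the
    indicator of the first [m] indices. Subtracting a threshold from [b] therefore leaves the
    difference of the two sides unchanged and gives every term the right sign. *)
Lemma doubly_stochastic_heads d (p : 'I_d -> 'I_d -> R) (b : 'I_d -> R) m :
  doubly_stochastic p -> antitone b ->
  \sum_(k < d | (k < m)%N) \sum_l p k l * b l <= \sum_(k < d | (k < m)%N) b k.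
Proof.
move=> [p0 prow pcol] anti.
have [c0 /(antitone_threshold m anti)[c _ thr]] := antitone_lbound anti.
pose q l := \sum_(k < d | (k < m)%N) p k l.
have q0 l : 0 <= q l by apply: sumr_ge0.
have q1 l : q l <= 1.
  rewrite -(pcol l) [leRHS](bigID (fun k : 'I_d => (k < m)%N)) /= lerDl.
  exact: sumr_ge0.
have qsum : \sum_l q l = \sum_(l < d) (l < m)%N%:R.
  rewrite exchange_big /= big_mkcond; apply: eq_bigr => k _.
  by rewrite prow; case: ifP.
rewrite exchange_big /= [leRHS]big_mkcond /= -subr_ge0.
suff -> : \sum_(l < d) (if (l < m)%N then b l else 0) -
          \sum_l \sum_(k < d | (k < m)%N) p k l * b l =
          \sum_(l < d) ((l < m)%N%:R - q l) * (b l - c).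
  apply: sumr_ge0 => l _; have := thr l; have := q0 l; have := q1 l.
  case: ltnP => _ /= ? ? ?; nra.
have -> : \sum_(l < d) ((l < m)%N%:R - q l) * (b l - c) =
    \sum_(l < d) ((l < m)%N%:R - q l) * b l - (\sum_(l < d) ((l < m)%N%:R - q l)) * c.
  by rewrite mulr_suml -sumrB; apply: eq_bigr => l _; rewrite mulrBr.
rewrite sumrB qsum subrr mul0r subr0.
under [RHS]eq_bigr do rewrite mulrBl.
rewrite sumrB; congr (_ - _); apply: eq_bigr => l _; last by rewrite mulr_suml.
by case: ifP; rewrite ?mul1r ?mul0r.
Qed.

Lemma doubly_stochastic_total d (p : 'I_d -> 'I_d -> R) (b : 'I_d -> R) :
  doubly_stochastic p -> \sum_k \sum_l p k l * b l = \sum_k b k.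
Proof.
move=> [_ _ pcol]; rewrite exchange_big; apply: eq_bigr => l _ /=.
by rewrite -mulr_suml pcol mul1r.
Qed.

(** Averaging by [p] lowers the partial sums of [b] and keeps its total; Abel summation with the
    antitone weights [- a] concludes. *)
Lemma doubly_stochastic_rearrangement d (p : 'I_d -> 'I_d -> R) (a b : 'I_d -> R) :
  doubly_stochastic p -> antitone (fun k => - a k) -> antitone b ->
  \sum_k a k * b k <= \sum_k a k * \sum_l p k l * b l.
Proof.
move=> ds anti_a anti_b; rewrite -subr_ge0.
pose x k := b k - \sum_l p k l * b l.
have := @abel_sum_ge0 _ (fun k => - a k) x anti_a.
rewrite -sumrB (_ : \sum_k - a k * x k = \sum_k (a k * (\sum_l p k l * b l) - a k * b k)).
  apply; last by right; rewrite /x sumrB doubly_stochastic_total ?subrr.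
  by move=> m; rewrite sumrB subr_ge0; exact: doubly_stochastic_heads.
by apply: eq_bigr => k _; rewrite /x; ring.
Qed.

(* The sums of squares force [tau] to be the extreme point [a - b] of the
   majorization inequalities, so that both of them are equalities. *)
Lemma doubly_stochastic_rigidity d (p q : 'I_d -> 'I_d -> R) (a b tau : 'I_d -> R) :
  doubly_stochastic p -> doubly_stochastic q ->
  antitone (fun k => - a k) -> antitone b -> antitone (fun k => - tau k) ->
  (forall k, tau k = \sum_l p k l * a l - \sum_l q k l * b l) ->
  \sum_k tau k ^+ 2 = \sum_k (a k - b k) ^+ 2 ->
  forall k, \sum_l p k l * a l = a k /\ \sum_l q k l * b l = b k.
Proof.
move=> dsp dsq anti_a anti_b anti_tau tauE sq.
pose al k := \sum_l p k l * a l; pose be k := \sum_l q k l * b l.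
have headsa m : \sum_(k < d | (k < m)%N) a k <= \sum_(k < d | (k < m)%N) al k.
  rewrite -lerN2 -!sumrN; apply: le_trans (doubly_stochastic_heads m dsp anti_a).
  rewrite le_eqVlt; apply/predU1P; left; apply: eq_bigr => k _.
  rewrite /al -sumrN; apply: eq_bigr => l _.
  by rewrite mulrN.
have headsb m := doubly_stochastic_heads m dsq anti_b.
(* As [tau = al - be], this bounds the squared norm of [tau] by its inner product with [a - b]. *)
have tz : 0 <= \sum_k - tau k * (al k - be k - (a k - b k)).
  apply: abel_sum_ge0 => // [m|].
    rewrite !sumrB; have := headsa m; have := headsb m; rewrite /be; lra.
  by right; rewrite !sumrB !doubly_stochastic_total // subrr.
(* The squared distance from [tau] to [a - b], once expanded with equal norms, is nonpositive by
   [tz]. *)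
have eqz k : tau k = a k - b k.
  have : \sum_k (tau k - (a k - b k)) ^+ 2 <= 0.
    have -> : \sum_k (tau k - (a k - b k)) ^+ 2 =
        \sum_k (a k - b k) ^+ 2 - \sum_k tau k ^+ 2
        - (\sum_k - tau k * (al k - be k - (a k - b k))) *+ 2.
      rewrite -!sumrMnl -!sumrB; apply: eq_bigr => i _.
      by rewrite -/(al i) -/(be i) tauE -/(al i) -/(be i); ring.
    rewrite sq; lra.
  move=> le0; have /eqP : \sum_k (tau k - (a k - b k)) ^+ 2 = 0.
    by apply/eqP; rewrite eq_le le0 sumr_ge0 // => i _; exact: sqr_ge0.
  rewrite psumr_eq0 => [/allP /(_ k)|i _]; last exact: sqr_ge0.
  by rewrite mem_index_enum /= sqrf_eq0 subr_eq0 => /(_ isT) /eqP.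
(* The heads of [al - a] are nonnegative, those of [be - b] are nonpositive, and by [eqz] they
   coincide. *)
have heads0 m : \sum_(k < d | (k < m)%N) (al k - a k) = 0.
  apply/eqP; rewrite eq_le sumrB subr_ge0 headsa andbT subr_le0.
  have := headsb m; rewrite -/be => hb.
  have : \sum_(k < d | (k < m)%N) al k - \sum_(k < d | (k < m)%N) a k =
         \sum_(k < d | (k < m)%N) be k - \sum_(k < d | (k < m)%N) b k.
    rewrite -!sumrB; apply: eq_bigr => k _.
    by have := eqz k; rewrite tauE -/(al k) -/(be k); lra.
  by rewrite /be; lra.
move=> k; have ak : al k = a k.
  have := heads0 k.+1.
  rewrite (bigD1 k) //= (eq_bigl (fun i : 'I_d => (i < k)%N)) => [|i].
    by rewrite heads0; lra.
  by rewrite ltnS ltn_neqAle andbC.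
by split=> //; have := eqz k; rewrite tauE -/(al k) ak -/(be k); lra.
Qed.

(** Take [t] between the first [m] values of [mu] and the others: the right-hand sum becomes the
    head of [mu] plus copies of [t], while the left-hand one is at least the head of [z] plus as
    many copies. *)
Lemma weak_majorization_heads d (z mu : 'I_d -> R) :
  antitone mu -> (forall k, 0 <= mu k) ->
  (forall t, 0 <= t -> \sum_k Num.max (z k) t <= \sum_k Num.max (mu k) t) ->
  forall m, \sum_(k < d | (k < m)%N) z k <= \sum_(k < d | (k < m)%N) mu k.
Proof.
move=> anti mu0 maj m; have [t t0 thr] := antitone_threshold m anti mu0.
have := maj t t0; rewrite [leLHS](bigID (fun k : 'I_d => (k < m)%N)) /=.
rewrite [leRHS](bigID (fun k : 'I_d => (k < m)%N)) /=.
have -> : \sum_(k < d | (k < m)%N) Num.max (mu k) t = \sum_(k < d | (k < m)%N) mu k.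
  by apply: eq_bigr => k km; have := thr k; rewrite km => /max_idPl.
have -> : \sum_(k < d | ~~ (k < m)%N) Num.max (mu k) t = \sum_(k < d | ~~ (k < m)%N) t.
  by apply: eq_bigr => k /negbTE km; have := thr k; rewrite km => /max_idPr.
move=> le.
have lez : \sum_(k < d | (k < m)%N) z k <= \sum_(k < d | (k < m)%N) Num.max (z k) t.
  by apply: ler_sum => k _; rewrite le_max lexx.
have let' : \sum_(k < d | ~~ (k < m)%N) t <= \sum_(k < d | ~~ (k < m)%N) Num.max (z k) t.
  by apply: ler_sum => k _; rewrite le_max lexx orbT.
lra.
Qed.

Lemma convex_ge0_slope (h : R -> R) x y z : Conv_ge0 h -> 0 <= x -> x < y -> y < z ->
  (h y - h x) / (y - x) <= (h z - h y) / (z - y).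
Proof.
move=> [_ cvx] x0 xy yz.
have xz : 0 < z - x by lra.
have t01 : 0 <= (z - y) / (z - x) <= 1.
  by rewrite divr_ge0 ?ler_pdivrMr /=; lra.
have /andP[t0 t1] := t01.
have := cvx (Itv01 t0 t1) x z.
rewrite !inE /= !in_itv /= !andbT x0 => /(_ isT (ltW (le_lt_trans x0 (lt_trans xy yz)))).
rewrite [X in h X](_ : _ = y); last first.
  have := xz; rewrite /conv /= /unstable.onem => ?.
  change ((z - y) / (z - x) * x + (1 - (z - y) / (z - x)) * z = y).
  field; lra.
change (h y <= (z - y) / (z - x) * h x + (1 - (z - y) / (z - x)) * h z -> 
   (h y - h x) / (y - x) <= (h z - h y) / (z - y)).
have -> : (z - y) / (z - x) * h x + (1 - (z - y) / (z - x)) * h z =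
    ((z - y) * h x + (y - x) * h z) / (z - x) by field; lra.
rewrite ler_pdivlMr // => le.
rewrite ler_pdivrMr; last lra.
rewrite mulrAC ler_pdivlMr; last lra.
nra.
Qed.

(** The witness is the left derivative, the supremum of the chord slopes on the left of [z]; the
    slopes on the right bound it. Positivity of [z] makes the set of slopes nonempty. *)
Lemma convex_ge0_subgradient (h : R -> R) z : Conv_ge0 h -> 0 < z ->
  exists s, forall y, 0 <= y -> h z + s * (y - z) <= h y.
Proof.
move=> cvx z0.
pose S := [set (h z - h x) / (z - x) | x in [set x | 0 <= x < z]].
have ubS y : z < y -> ubound S ((h y - h z) / (y - z)).
  by move=> zy _ [x /= /andP[x0 xz] <-]; exact: convex_ge0_slope.
have hS : has_sup S.
  split; first by exists ((h z - h 0) / (z - 0)), 0 => //=; rewrite lexx.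
  by exists ((h (z + 1) - h z) / (z + 1 - z)); apply: ubS; lra.
exists (sup S) => y y0.
have [yz|zy|->] := ltgtP y z; last by rewrite subrr mulr0 addr0.
  have /(sup_upper_bound hS) : S ((h z - h y) / (z - y)).
    by exists y => //=; rewrite y0.
  rewrite ler_pdivrMr; last lra.
  lra.
have : sup S <= (h y - h z) / (y - z) by apply: sup_le_ub; [case: hS | exact: ubS].
rewrite ler_pdivlMr; last lra.
lra.
Qed.

(** Summing the tangent inequalities at the points [z k] leaves a linear term, nonnegative by Abel
    summation because the slopes are antitone and nonnegative. Equality of the sums makes every
    tangent inequality tight. *)
Lemma weak_majorization_convex d (h : R -> R) (z mu : 'I_d -> R) :
  Conv_ge0 h -> nondecreasing_ge0 h -> antitone z -> (forall k, 0 < z k) ->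
  (forall k, 0 <= mu k) ->
  (forall m, \sum_(k < d | (k < m)%N) z k <= \sum_(k < d | (k < m)%N) mu k) ->
  \sum_k h (z k) <= \sum_k h (mu k) /\
  (strictly_convex_ge0 h -> \sum_k h (mu k) <= \sum_k h (z k) ->
   forall k, mu k = z k).
Proof.
move=> cvx incr anti z0 mu0 heads.
(* The slope is a function of the point, so equal entries of [z] have equal slopes. *)
pose s x := xget 0 [set s | forall y, 0 <= y -> h x + s * (y - x) <= h y].
have sP x y : 0 < x -> 0 <= y -> h x + s x * (y - x) <= h y.
  move=> x0; rewrite /s; case: xgetP => [_ _ /(_ y)//|].
  by have [r hr] := convex_ge0_subgradient cvx x0 => /(_ r).
have lin : 0 <= \sum_k s (z k) * (mu k - z k).
  apply: abel_sum_ge0 => [i j ij|m|].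
  - have := anti i j ij; rewrite le_eqVlt => /predU1P[->//|lt].
    have := sP _ _ (z0 i) (ltW (z0 j)); have := sP _ _ (z0 j) (ltW (z0 i)).
    by move: (s (z i)) (s (z j)) => si sj ? ?; nra.
  - by rewrite sumrB subr_ge0.
  - left=> i; have := sP _ _ (z0 i) (lexx 0); have := incr _ _ (lexx 0) (ltW (z0 i)).
    have := z0 i; move: (s (z i)) => si ? ? ?; nra.
have lek k : h (z k) + s (z k) * (mu k - z k) <= h (mu k) by exact: sP.
have gap : 0 <= \sum_k (h (mu k) - h (z k) - s (z k) * (mu k - z k)).
  by apply: sumr_ge0 => k _; have := lek k; lra.
have gapE : \sum_k (h (mu k) - h (z k) - s (z k) * (mu k - z k)) =
    \sum_k h (mu k) - \sum_k h (z k) - \sum_k s (z k) * (mu k - z k).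
  by rewrite !sumrB.
split=> [|scvx le k]; first by lra.
apply: contrapT => /eqP neq.
have /eqP : \sum_k (h (mu k) - h (z k) - s (z k) * (mu k - z k)) = 0.
  by apply/eqP; rewrite eq_le gap andbT gapE; lra.
rewrite psumr_eq0 => [/allP /(_ k)|i _]; last by have := lek i; lra.
rewrite mem_index_enum /= => /(_ isT) /eqP e0.
(* The tangent at [z k] meets the graph at [mu k]; strict convexity would push the midpoint below
   that tangent. *)
have half : 0 < 2^-1 :> R /\ 2^-1 < 1 :> R by split; lra.
have := scvx _ _ _ (mu0 k) (ltW (z0 k)) neq half.1 half.2.
have mid0 : 0 <= 2^-1 * mu k + (1 - 2^-1) * z k.
  by have := mu0 k; have := z0 k; lra.
have := sP _ _ (z0 k) mid0.
have -> : 2^-1 * mu k + (1 - 2^-1) * z k - z k = 2^-1 * (mu k - z k) by field.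
lra.
Qed.

End Majorization.

(** * Decreasing rearrangements of finite families *)

Section Sorting.
Variable R : realType.

Lemma nth_map_enum_ord d (f : 'I_d -> R) (k : 'I_d) :
  [seq f i | i <- enum 'I_d]`_k = f k.
Proof. by rewrite (nth_map k) ?size_enum_ord // nth_ord_enum. Qed.

Lemma antitone_sort d (f : 'I_d -> R) :
  exists s : {perm 'I_d}, antitone (fun k => f (s k)) /\
    decreasing_rearrangement f = [seq f (s k) | k <- enum 'I_d].
Proof.
pose t := [tuple f i | i < d].
have /tuple_permP[s sE] : perm_eq (sort >=%R t) t by rewrite perm_sort.
have valt i : tnth t i = f i by rewrite tnth_mktuple.
have sE' : sort >=%R t = [seq f (s k) | k <- enum 'I_d].
  by rewrite sE /=; apply: eq_map => i; rewrite valt.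
have tot : total (>=%R : rel R) by move=> x y; exact: le_total.
exists s; split; last first.
  by rewrite /decreasing_rearrangement -sE' /=.
move=> i j ij; have := sort_sorted tot t; rewrite sE' => srt.
have mem (k : 'I_d) : (k : nat) \in [pred n | (n < size [seq f (s k) | k <- enum 'I_d])%N].
  by rewrite inE size_map size_enum_ord.
have := sorted_leq_nth ge_trans ge_refl 0 srt i j (mem i) (mem j) ij.
by rewrite !(nth_map_enum_ord (fun k => f (s k))).
Qed.

Lemma antitone_nth d (f : 'I_d -> R) (k : 'I_d) : antitone f ->
  (decreasing_rearrangement f)`_k = f k.
Proof.
move=> anti; rewrite /decreasing_rearrangement.
have tr : transitive (>=%R : rel R) by exact: ge_trans.
rewrite sorted_sort //; first by rewrite nth_map_enum_ord.
apply/(sortedP 0) => i; rewrite size_map size_enum_ord => lti.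
rewrite (nth_map_enum_ord f (Ordinal (ltnW lti))) (nth_map_enum_ord f (Ordinal lti)).
exact: (anti (Ordinal (ltnW lti)) (Ordinal lti)).
Qed.

End Sorting.

(** * Orthonormal bases *)

Section InnerProduct.
Variables (R : realType) (H : hilbertType R).
Implicit Types x y z : H.

Lemma innerC x y : '[y, x] = Num.conj '[x, y].
Proof. by rewrite (hermitian_subproof y x) expr0 mul1r. Qed.

Lemma inner_suml I r (P : pred I) (f : I -> H) y :
  '[\sum_(i <- r | P i) f i, y] = \sum_(i <- r | P i) '[f i, y].
Proof. exact: linear_sumlz. Qed.

Lemma inner_sumr I r (P : pred I) (f : I -> H) y :
  '[y, \sum_(i <- r | P i) f i] = \sum_(i <- r | P i) '[y, f i].
Proof. exact: linear_sumr. Qed.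

Lemma innerZl a x y : '[a *: x, y] = a * '[x, y].
Proof. by rewrite linearZl_LR. Qed.

Lemma innerZr a x y : '[x, a *: y] = Num.conj a * '[x, y].
Proof. by rewrite linearZr_LR. Qed.

Lemma innerDl x y z : '[x + y, z] = '[x, z] + '[y, z].
Proof. exact: linearDl. Qed.

Lemma innerBl x y z : '[x - y, z] = '[x, z] - '[y, z].
Proof. exact: linearBl. Qed.

Lemma innerBr x y z : '[z, x - y] = '[z, x] - '[z, y].
Proof. exact: linearBr. Qed.

Lemma inner0l x : '[0, x] = 0.
Proof. exact: linear0l. Qed.

Lemma inner_self_ge0 x : 0 <= '[x, x].
Proof. exact: dnorm_ge0. Qed.

Lemma inner_self_eq0 x : '[x, x] = 0 -> x = 0.
Proof. by move/eqP; rewrite dnorm_eq0 => /eqP. Qed.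

Lemma inner_ext x y : (forall z, '[x, z] = '[y, z]) -> x = y.
Proof.
move=> e; apply/eqP; rewrite -subr_eq0; apply/eqP/inner_self_eq0.
by rewrite innerBl e subrr.
Qed.

Lemma conj_realC (a : R) : Num.conj a%:C = a%:C.
Proof. by apply: conj_Creal; apply/complex_realP; exists a. Qed.

(** The squared modulus of the inner product, valued in [R] rather than [R[i]] so that it can be an
    entry of a real doubly stochastic matrix. *)
Definition inner_sq x y : R := complex.Re '[x, y] ^+ 2 + complex.Im '[x, y] ^+ 2.

Lemma inner_sqE x y : (inner_sq x y)%:C = '[x, y] * '[y, x].
Proof. by rewrite /inner_sq add_Re2_Im2 normCK -innerC. Qed.

Lemma inner_sq_ge0 x y : 0 <= inner_sq x y.
Proof. by rewrite addr_ge0 ?sqr_ge0. Qed.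

Lemma inner_sqC x y : inner_sq x y = inner_sq y x.
Proof. by apply: complexI; rewrite !inner_sqE mulrC. Qed.

Lemma inner_sq_eq0 x y : inner_sq x y = 0 -> '[x, y] = 0.
Proof.
move=> e; have := inner_sqE x y; rewrite e => /esym/eqP.
by rewrite [_ == 0]mulf_eq0 (innerC x y) conjC_eq0 orbb => /eqP.
Qed.

Definition orthonormal_family d (e : 'I_d -> H) := forall i j, '[e i, e j] = (i == j)%:R.

Lemma orthonormal_synthesis d (e : 'I_d -> H) a i : orthonormal_family e ->
  '[synthesis e a, e i] = a i.
Proof.
move=> on; rewrite inner_suml (bigD1 i) //= innerZl on eqxx mulr1.
by rewrite big1 ?addr0 // => j /negbTE ji; rewrite innerZl on ji mulr0.
Qed.

Lemma orthonormal_lin_indep d (e : 'I_d -> H) : orthonormal_family e -> lin_indep e.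
Proof.
by move=> on a a0 i; rewrite -(orthonormal_synthesis a i on) a0 inner0l.
Qed.

Section Span.
Variables (m : nat) (g : 'I_m -> H).

Lemma lspan_gen i : lspan g (g i).
Proof.
exists (fun j => (j == i)%:R) => //.
rewrite /synthesis (bigD1 i) //= eqxx scale1r big1 ?addr0 // => j /negbTE ->.
by rewrite scale0r.
Qed.

Lemma lspanZ a x : lspan g x -> lspan g (a *: x).
Proof.
move=> [c _ <-]; exists (fun i => a * c i) => //.
by rewrite /synthesis scaler_sumr; apply: eq_bigr => i _; rewrite scalerA.
Qed.

Lemma lspanD x y : lspan g x -> lspan g y -> lspan g (x + y).
Proof.
move=> [a _ <-] [b _ <-]; exists (fun i => a i + b i) => //.
by rewrite /synthesis -big_split; apply: eq_bigr => i _; rewrite scalerDl.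
Qed.

Lemma lspan0 : lspan g 0.
Proof. by exists (fun=> 0) => //; rewrite /synthesis big1 // => i _; rewrite scale0r. Qed.

Lemma lspanB x y : lspan g x -> lspan g y -> lspan g (x - y).
Proof. by move=> gx gy; apply: lspanD => //; rewrite -scaleN1r; exact: lspanZ. Qed.

Lemma lspan_synthesis n (f : 'I_n -> H) a :
  (forall i, lspan g (f i)) -> lspan g (synthesis f a).
Proof.
move=> gf; rewrite /synthesis; elim/big_ind: _ => [|x y|i _].
- exact: lspan0.
- exact: lspanD.
- exact/lspanZ/gf.
Qed.

Lemma lspan_sub n (f : 'I_n -> H) :
  (forall i, lspan g (f i)) -> lspan f `<=` lspan g.
Proof. by move=> gf _ [a _ <-]; exact: lspan_synthesis. Qed.

Lemma lspan_inner0 x : (forall i, '[x, g i] = 0) -> forall z, lspan g z -> '[x, z] = 0.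
Proof.
move=> x0 _ [a _ <-]; rewrite inner_sumr big1 // => i _.
by rewrite innerZr x0 mulr0.
Qed.

End Span.

Section OrthonormalBasis.
Variables (W : set H) (d : nat) (e : 'I_d -> H).
Hypothesis onbe : orthonormal_basis W e.

Let on : orthonormal_family e := onbe.1.
Let spanE : lspan e = W := onbe.2.

Lemma onb_mem i : W (e i).
Proof. by rewrite -spanE; exact: lspan_gen. Qed.

Lemma onb_expansion z : W z -> z = \sum_k '[z, e k] *: e k.
Proof.
rewrite -spanE => -[a _ <-]; apply: eq_bigr => k _.
by rewrite orthonormal_synthesis.
Qed.

Lemma onb_parseval x y : W x -> '[x, y] = \sum_k '[x, e k] * '[e k, y].
Proof.
move=> Wx; rewrite {1}(onb_expansion Wx) inner_suml.
by apply: eq_bigr => k _; rewrite innerZl.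
Qed.

Lemma onb_inner_ext x y : W x -> W y -> (forall k, '[x, e k] = '[y, e k]) -> x = y.
Proof.
move=> Wx Wy xy; rewrite (onb_expansion Wx) (onb_expansion Wy).
by apply: eq_bigr => k _; rewrite xy.
Qed.

Lemma onb_perm (s : 'I_d -> 'I_d) : injective s -> orthonormal_basis W (fun k => e (s k)).
Proof.
move=> inj; split=> [i j|]; first by rewrite on (inj_eq inj).
rewrite -spanE; apply/seteqP; split; apply: lspan_sub => i; first exact: lspan_gen.
rewrite -(f_invF inj i); exact: (lspan_gen (fun k => e (s k))).
Qed.

End OrthonormalBasis.

Lemma onb_sum_inner_sq (W : set H) d (e : 'I_d -> H) x :
  orthonormal_basis W e -> W x -> (\sum_k inner_sq x (e k))%:C = '[x, x].
Proof.
move=> onbe Wx; rewrite (onb_parseval onbe x Wx) rmorph_sum.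
by apply: eq_bigr => k _; exact: inner_sqE.
Qed.

(** Both marginals are Parseval's identity for unit vectors. *)
Lemma onb_doubly_stochastic (W : set H) d (e f : 'I_d -> H) :
  orthonormal_basis W e -> orthonormal_basis W f ->
  doubly_stochastic (fun k l => inner_sq (e k) (f l)).
Proof.
move=> onbe onbf; split=> [k l|k|l].
- exact: inner_sq_ge0.
- by apply: complexI; rewrite (onb_sum_inner_sq onbf) ?onbe.1 ?eqxx //; exact: (onb_mem onbe).
- apply: complexI; under eq_bigr do rewrite inner_sqC.
  by rewrite (onb_sum_inner_sq onbe) ?onbf.1 ?eqxx // -onbf.2; exact: lspan_gen.
Qed.

End InnerProduct.

(** * Spectra of weighted frame operators *)

Section WeightedFrameOperator.
Variables (R : realType) (H : hilbertType R).
Implicit Types x y z : H.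

(** For orthonormal [g] this is a spectral decomposition; with unit weights it is the frame operator
    of [g], or the orthogonal projection when [g] is orthonormal. *)
Definition wop n (b : 'I_n -> R) (g : 'I_n -> H) z : H :=
  \sum_k ((b k)%:C * '[z, g k]) *: g k.

Section Theory.
Variables (n : nat) (b : 'I_n -> R) (g : 'I_n -> H).

Lemma wop_linear : linear (wop b g).
Proof.
move=> a x y; rewrite scaler_sumr -big_split; apply: eq_bigr => k _ /=.
by rewrite innerDl innerZl scalerA -scalerDl mulrDr mulrCA.
Qed.

Lemma wop_inner x y : '[wop b g x, y] = \sum_k (b k)%:C * ('[x, g k] * '[g k, y]).
Proof. by rewrite inner_suml; apply: eq_bigr => k _; rewrite innerZl mulrA. Qed.

Lemma wop_selfadjoint x y : '[wop b g x, y] = '[x, wop b g y].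
Proof.
rewrite wop_inner inner_sumr; apply: eq_bigr => k _.
by rewrite innerZr rmorphM /= conj_realC -innerC; ring.
Qed.

Lemma wop_quad x : '[wop b g x, x] = (\sum_k b k * inner_sq x (g k))%:C.
Proof.
rewrite wop_inner rmorph_sum; apply: eq_bigr => k _.
by rewrite [RHS]rmorphM /= inner_sqE.
Qed.

Lemma wop_lspan x : lspan g (wop b g x).
Proof. by exists (fun k => (b k)%:C * '[x, g k]). Qed.

Lemma wop_orthonormal k : orthonormal_family g -> wop b g (g k) = (b k)%:C *: g k.
Proof.
move=> on; rewrite /wop (bigD1 k) //= on eqxx mulr1 big1 ?addr0 // => l /negbTE lk.
by rewrite on eq_sym lk mulr0 scale0r.
Qed.

Lemma wop_eigen W z c : orthonormal_basis W g -> W z ->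
  (forall l, b l != c -> '[z, g l] = 0) -> wop b g z = c%:C *: z.
Proof.
move=> onb Wz z0; rewrite {2}(onb_expansion onb Wz) scaler_sumr.
apply: eq_bigr => l _; rewrite scalerA; have [->//|/z0 ->] := eqVneq (b l) c.
by rewrite !mulr0.
Qed.

End Theory.

(** The matrix [N] of [T] in the basis [w] is Hermitian. The rows of the unitary matrix
    diagonalizing it are the coordinates of the eigenvectors, which are finally sorted by
    eigenvalue. *)
Lemma spectral_onb (W : set H) d (w : 'I_d -> H) (T : H -> H) :
  orthonormal_basis W w -> linear T ->
  (forall x y, '[T x, y] = '[x, T y]) -> (forall x, W x -> W (T x)) ->
  exists e (be : 'I_d -> R), [/\ orthonormal_basis W e, antitone be &
    forall k, T (e k) = (be k)%:C *: e k].
Proof.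
move=> onb linT herm TW.
pose N := \matrix_(k, l) '[T (w k), w l].
have hermN : N \is hermsymmx.
  apply/is_hermitianmxP; rewrite expr0 scale1r; apply/matrixP => k l.
  by rewrite !mxE herm innerC.
have /orthomx_spectralP NE := hermitian_normalmx hermN.
have realD := hermitian_spectral_diag_real hermN.
pose P := spectralmx N; pose D := spectral_diag N.
have unitP : P \is unitarymx by exact: spectral_unitarymx.
have PN : P *m N = diag_mx D *m P.
  by rewrite [in LHS]NE !mulmxA mulmxV ?mul1mx // unitarymx_unit.
pose be k := complex.Re (D 0 k).
have beE k : (be k)%:C = D 0 k by apply: RRe_real; exact: (mxOverP realD).
pose e k := \sum_l P k l *: w l.
have We k : W (e k) by rewrite -onb.2; exists (fun l => P k l).
have ew k l : '[e k, w l] = P k l by exact: (orthonormal_synthesis (P k) l onb.1).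
have one : orthonormal_family e.
  move=> i j; rewrite (onb_parseval onb) //.
  have /unitarymxP/matrixP/(_ i j) := unitP; rewrite !mxE => <-.
  by apply: eq_bigr => k _; rewrite ew innerC ew !mxE.
have onbe : orthonormal_basis W e.
  split=> //; rewrite -onb.2; apply/seteqP; split; apply: lspan_sub => i.
    by exists (fun l => P i l).
  exists (fun k => Num.conj (P k i)) => //.
  apply: (onb_inner_ext onb) => [||l]; [|exact: (onb_mem onb)|].
    rewrite -onb.2; apply: lspan_synthesis => k; rewrite onb.2; exact: We.
  rewrite inner_suml onb.1; under eq_bigr do rewrite innerZl ew.
  have /unitarymx_unit/mulVmx := unitP; rewrite invmx_unitary // => /matrixP/(_ i l).
  by rewrite !mxE => <-; apply: eq_bigr => k _; rewrite !mxE.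
have Te k : T (e k) = (be k)%:C *: e k.
  apply: (onb_inner_ext onb) => [||l]; first exact/TW/We.
    by rewrite -onb.2; apply: lspanZ; rewrite onb.2; exact: We.
  rewrite innerZl ew beE herm.
  have /matrixP/(_ k l) := PN; rewrite mul_diag_mx !mxE => <-.
  rewrite (onb_parseval onb) //; apply: eq_bigr => m _.
  by rewrite ew mxE herm.
have [s [anti _]] := antitone_sort be.
exists (fun k => e (s k)), (fun k => be (s k)); split=> //.
exact: (onb_perm onbe perm_inj).
Qed.

Lemma eigenbasis_quad (W : set H) d (e : 'I_d -> H) (be : 'I_d -> R) T z :
  orthonormal_basis W e -> (forall x y, '[T x, y] = '[x, T y]) ->
  (forall k, T (e k) = (be k)%:C *: e k) -> W z ->
  '[T z, z] = (\sum_k be k * inner_sq z (e k))%:C.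
Proof.
move=> onb herm Te Wz; rewrite herm (onb_parseval onb) // rmorph_sum.
apply: eq_bigr => k _.
by rewrite -herm Te innerZl [RHS]rmorphM /= inner_sqE mulrCA.
Qed.

(* Courant-Fischer: the span of [e 0 .. e k] meets the orthocomplement of
   [f 0 .. f (k-1)]; the zero column of the matrix below forces a solution. *)
Lemma eigenvalue_monotone (W : set H) d (e f : 'I_d -> H) (be ga : 'I_d -> R) :
  orthonormal_basis W e -> orthonormal_basis W f -> antitone be -> antitone ga ->
  (forall z, W z -> \sum_k be k * inner_sq z (e k) <= \sum_k ga k * inner_sq z (f k)) ->
  forall k, be k <= ga k.
Proof.
move=> onbe onbf anti_be anti_ga le k.
(* For a row vector killed by [M], the columns [j < k] say that [z] is orthogonal to [f j], and the
   columns [j > k] that its coordinates beyond [k] vanish. *)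
pose M : 'M[R[i]]_d := \matrix_(i, j)
  if (j < k)%N then '[e i, f j] else if j == k then 0 else (i == j)%:R.
have /det0P[c c0 cM] : \det M == 0.
  rewrite (expand_det_col M k) big1 // => i _.
  by rewrite mxE ltnn eqxx mul0r.
pose z := synthesis e (c 0).
have Wz : W z by rewrite -onbe.2; exists (c 0).
have ze i : '[z, e i] = c 0 i by exact: orthonormal_synthesis onbe.1.
have ze0 (i : 'I_d) : (k < i)%N -> '[z, e i] = 0.
  move=> ki; have /matrixP/(_ 0 i) := cM; rewrite !mxE => <-.
  rewrite ze (bigD1 i) //= mxE ltnNge (ltnW ki) /= gt_eqF // eqxx mulr1.
  rewrite big1 ?addr0 // => j /negbTE ji.
  by rewrite mxE ltnNge (ltnW ki) /= gt_eqF // ji mulr0.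
have zf0 (j : 'I_d) : (j < k)%N -> '[z, f j] = 0.
  move=> jk; have /matrixP/(_ 0 j) := cM; rewrite !mxE => <-.
  by rewrite inner_suml; apply: eq_bigr => i _; rewrite innerZl mxE jk.
have sq0 x y : '[x, y] = 0 -> inner_sq x y = 0.
  by move=> xy; apply: complexI; rewrite inner_sqE xy mul0r.
have [i ci] : exists i, c 0 i != 0.
  apply: contrapT => /forallNP c_0; move/eqP: c0; apply; apply/rowP => i.
  by rewrite mxE; apply/eqP; rewrite -[_ == _]negbK; apply/negP/c_0.
have e_total := onb_sum_inner_sq onbe Wz; have f_total := onb_sum_inner_sq onbf Wz.
have pos : 0 < \sum_k inner_sq z (e k).
  rewrite lt_def sumr_ge0 ?andbT => [|j _]; last exact: inner_sq_ge0.
  rewrite psumr_eq0 => [|j _]; last exact: inner_sq_ge0.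
  apply/negP => /allP/(_ i); rewrite mem_index_enum => /(_ isT)/eqP/inner_sq_eq0.
  by rewrite ze => /eqP; rewrite (negbTE ci).
(* On [z], the first quadratic form is at least [be k] times the squared norm and the second at most
   [ga k] times it. *)
rewrite -(ler_pM2r pos).
apply: (@le_trans _ _ (\sum_k be k * inner_sq z (e k))).
  rewrite mulr_sumr; apply: ler_sum => j _; case: (ltnP k j) => [/ze0/sq0 ->|jk].
    by rewrite !mulr0.
  by apply: ler_wpM2r; [exact: inner_sq_ge0|exact: anti_be].
apply: (le_trans (le z Wz)).
have -> : \sum_k inner_sq z (e k) = \sum_k inner_sq z (f k).
  by apply: complexI; rewrite [LHS]e_total -f_total.
rewrite mulr_sumr; apply: ler_sum => j _; case: (ltnP j k) => [/zf0/sq0 ->|jk].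
  by rewrite !mulr0.
by apply: ler_wpM2r; [exact: inner_sq_ge0|exact: anti_ga].
Qed.

(* [u] is an orthonormal basis of a space V at principal angles
   [a k = cos^-2] from W. Truncating the spectrum of the operator
   [wop mu u] at level [t] and compressing back to W gives an operator [B]
   which dominates both [wop b y] and [t / a], and whose trace against
   [wop a w] is the truncated trace. *)
Lemma truncated_trace_le (W : set H) d (w y u : 'I_d -> H) (a b mu : 'I_d -> R) :
  orthonormal_basis W w -> orthonormal_basis W y ->
  (forall k, 0 < a k) -> antitone (fun k => - a k) -> antitone b ->
  (forall z, W z -> \sum_k b k * inner_sq z (y k) = \sum_k mu k * inner_sq z (u k)) ->
  (forall z, W z -> \sum_k inner_sq z (u k) = \sum_k (a k)^-1 * inner_sq z (w k)) ->
  (forall i, \sum_k a k * inner_sq (w k) (u i) = 1) ->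
  forall t, 0 <= t -> \sum_k Num.max (a k * b k) t <= \sum_k Num.max (mu k) t.
Proof.
move=> onbw onby a0 anti_a anti_b quad_b quad_u tr_u t t0.
(* The orthogonal projection of [u i] onto [W]: it has the same inner products with vectors of [W],
   and stays in [W]. *)
pose pu i := \sum_k '[u i, w k] *: w k.
have Wpu i : W (pu i) by rewrite -onbw.2; exists (fun k => '[u i, w k]).
have sq_pu z i : W z -> inner_sq z (pu i) = inner_sq z (u i).
  move=> Wz; have zp : '[z, pu i] = '[z, u i].
    rewrite inner_sumr (onb_parseval onbw) //; apply: eq_bigr => k _.
    by rewrite innerZr -innerC mulrC.
  by rewrite /inner_sq zp.
pose nu k := Num.max (mu k) t.
have TW x : W x -> W (wop nu pu x).
  move=> _; rewrite -onbw.2; apply: lspan_sub (wop_lspan _ _ _) => i.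
  by rewrite onbw.2.
have [e [be [onbe anti_be Te]]] :=
  spectral_onb onbw (wop_linear nu pu) (wop_selfadjoint nu pu) TW.
have quad_be z : W z -> \sum_k be k * inner_sq z (e k) = \sum_k nu k * inner_sq z (u k).
  move=> Wz; apply: complexI.
  rewrite -[LHS](eigenbasis_quad onbe (wop_selfadjoint nu pu) Te Wz) wop_quad.
  by congr (_%:C); apply: eq_bigr => k _; rewrite sq_pu.
have b_le : forall k, b k <= be k.
  apply: (eigenvalue_monotone onby onbe anti_b anti_be) => z Wz.
  rewrite quad_b // quad_be //; apply: ler_sum => k _.
  by apply: ler_wpM2r; [exact: inner_sq_ge0|rewrite le_max lexx].
have t_le : forall k, t * (a k)^-1 <= be k.
  apply: (eigenvalue_monotone onbw onbe _ anti_be) => [i j ij|z Wz].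
    by apply: ler_wpM2l => //; rewrite lef_pV2 ?posrE // -lerN2; exact: anti_a.
  under eq_bigr do rewrite -mulrA.
  rewrite -mulr_sumr -quad_u // quad_be // mulr_sumr; apply: ler_sum => k _.
  by apply: ler_wpM2r; [exact: inner_sq_ge0|rewrite le_max lexx orbT].
apply: (@le_trans _ _ (\sum_k a k * be k)).
  apply: ler_sum => k _; rewrite ge_max ler_wpM2l ?b_le ?(ltW (a0 k)) //=.
  by rewrite mulrC -ler_pdivrMr // t_le.
apply: (le_trans (doubly_stochastic_rearrangement
  (onb_doubly_stochastic onbw onbe) anti_a anti_be)).
(* The trace of the product with [wop a w] is computed in the family [u], where [tr_u] gives every
   [nu l] the coefficient 1. *)
have -> : \sum_k a k * (\sum_l inner_sq (w k) (e l) * be l) =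
    \sum_k \sum_l nu l * (a k * inner_sq (w k) (u l)).
  apply: eq_bigr => k _; under eq_bigr do rewrite mulrC.
  rewrite quad_be ?mulr_sumr; last exact: (onb_mem onbw).
  by apply: eq_bigr => l _; rewrite mulrCA.
rewrite exchange_big; apply: ler_sum => l _ /=.
by rewrite -mulr_sumr tr_u mulr1.
Qed.

(* The common eigenbasis is an eigenbasis of the difference of the two operators. *)
Lemma rearrangement_equality (W : set H) d (w y : 'I_d -> H) (a b : 'I_d -> R) :
  orthonormal_basis W w -> orthonormal_basis W y ->
  antitone (fun k => - a k) -> antitone b ->
  \sum_k a k * (\sum_l inner_sq (w k) (y l) * b l) = \sum_k a k * b k ->
  exists2 e, orthonormal_basis W e & forall k l,
    (a l != a k -> '[e k, w l] = 0) /\ (b l != b k -> '[e k, y l] = 0).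
Proof.
move=> onbw onby anti_a anti_b tr.
(* The eigenvalues of this difference, sorted and negated, play the role of [tau] in the rigidity
   lemma. *)
pose T z := wop b y z - wop a w z.
have linT : linear T.
  move=> c x z; rewrite /T !wop_linear; rewrite scalerBr opprD !addrA; congr (_ + _).
  by rewrite -!addrA; congr (_ + _); rewrite addrC.
have hermT x z : '[T x, z] = '[x, T z].
  by rewrite innerBl innerBr !wop_selfadjoint.
have TW x : W x -> W (T x).
  move=> _; rewrite -onbw.2; apply: lspanB; last exact: wop_lspan.
  by rewrite onbw.2 -onby.2; exact: wop_lspan.
have [e [ga [onbe anti_ga Te]]] := spectral_onb onbw linT hermT TW.
have quadT z : W z -> \sum_k ga k * inner_sq z (e k) =
    \sum_k b k * inner_sq z (y k) - \sum_k a k * inner_sq z (w k).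
  move=> Wz; apply: complexI.
  rewrite -[LHS](eigenbasis_quad onbe hermT Te Wz) innerBl !wop_quad.
  by rewrite [in RHS]rmorphB.
have one_term c (g : 'I_d -> H) k : orthonormal_family g ->
    \sum_l c l * inner_sq (g k) (g l) = c k.
  move=> on; apply: complexI; rewrite -wop_quad wop_orthonormal // innerZl on eqxx.
  by rewrite mulr1.
have sum_swap (c : 'I_d -> R) (g : 'I_d -> H) k :
    \sum_l c l * inner_sq (e k) (g l) = \sum_l inner_sq (e k) (g l) * c l.
  by apply: eq_bigr => l _; rewrite mulrC.
have gaE k : - ga k = \sum_l inner_sq (e k) (w l) * a l - \sum_l inner_sq (e k) (y l) * b l.
  by rewrite -(one_term ga e k onbe.1) quadT ?opprB ?sum_swap //; exact: (onb_mem onbe).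
have dual_sum (c : 'I_d -> R) (g : 'I_d -> H) :
    \sum_k ga k * (\sum_l inner_sq (e k) (g l) * c l) =
    \sum_l c l * \sum_k ga k * inner_sq (g l) (e k).
  under eq_bigr do rewrite mulr_sumr.
  rewrite exchange_big; apply: eq_bigr => l _; rewrite mulr_sumr.
  by apply: eq_bigr => k _; rewrite inner_sqC; ring.
(* This is the trace of the square of [T]; its cross term, twice the trace of the product of the two
   operators, is known from [tr]. *)
have sqE : \sum_k (- ga k) ^+ 2 = \sum_k (a k - b k) ^+ 2.
  have -> : \sum_k (- ga k) ^+ 2 =
      \sum_k ga k * (\sum_l inner_sq (e k) (y l) * b l) -
      \sum_k ga k * (\sum_l inner_sq (e k) (w l) * a l).
    rewrite -sumrB; apply: eq_bigr => k _; rewrite expr2 [X in X * _ = _]gaE.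
    ring.
  rewrite !dual_sum.
  have Ey l : \sum_k ga k * inner_sq (y l) (e k) = b l - \sum_k a k * inner_sq (y l) (w k).
    by rewrite quadT ?one_term ?onby.1 //; [exact: onby.1|exact: (onb_mem onby)].
  have Ew l : \sum_k ga k * inner_sq (w l) (e k) = \sum_k b k * inner_sq (w l) (y k) - a l.
    by rewrite quadT ?one_term ?onbw.1 //; [exact: onbw.1|exact: (onb_mem onbw)].
  under eq_bigr do rewrite Ey mulrBr.
  under [X in _ - X = _]eq_bigr do rewrite Ew mulrBr.
  rewrite !sumrB.
  have -> : \sum_l b l * (\sum_k a k * inner_sq (y l) (w k)) = \sum_k a k * b k.
    rewrite -tr; under eq_bigr do rewrite mulr_sumr.
    rewrite exchange_big; apply: eq_bigr => k _; rewrite mulr_sumr.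
    by apply: eq_bigr => l _; rewrite inner_sqC; ring.
  have -> : \sum_l a l * (\sum_k b k * inner_sq (w l) (y k)) = \sum_k a k * b k.
    rewrite -tr; apply: eq_bigr => k _; congr (_ * _).
    by apply: eq_bigr => l _; rewrite mulrC.
  rewrite [RHS](_ : _ = \sum_k b k * b k - \sum_k a k * b k -
      (\sum_k a k * b k - \sum_k a k * a k)) // -!sumrB.
  by apply: eq_bigr => k _; ring.
have anti_N : antitone (fun k => - - ga k) by move=> i j /anti_ga; rewrite !opprK.
have rigid := doubly_stochastic_rigidity (onb_doubly_stochastic onbe onbw)
  (onb_doubly_stochastic onbe onby) anti_a anti_b anti_N gaE sqE.
(* Each row of the doubly stochastic matrix averages [c] to [c k]. The variances of [c] under the
   rows add up to zero, so each row is supported where [c l = c k]. *)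
have sharp (c : 'I_d -> R) (g : 'I_d -> H) : orthonormal_basis W g ->
    (forall k, \sum_l inner_sq (e k) (g l) * c l = c k) ->
    forall k l, c l != c k -> '[e k, g l] = 0.
  move=> onbg cE.
  have [p0 prow pcol] := onb_doubly_stochastic onbe onbg.
  have varE k : \sum_l inner_sq (e k) (g l) * (c l - c k) ^+ 2 =
      \sum_l inner_sq (e k) (g l) * c l ^+ 2 - c k ^+ 2.
    rewrite [RHS](_ : _ = \sum_l inner_sq (e k) (g l) * c l ^+ 2 -
      (c k * \sum_l inner_sq (e k) (g l) * c l) *+ 2 +
      c k ^+ 2 * \sum_l inner_sq (e k) (g l)); last by rewrite cE prow; ring.
    rewrite !mulr_sumr -sumrMnl -sumrB -big_split; apply: eq_bigr => l _ /=; ring.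
  have var0 k l : 0 <= inner_sq (e k) (g l) * (c l - c k) ^+ 2.
    by rewrite mulr_ge0 ?inner_sq_ge0 ?sqr_ge0.
  have : \sum_k \sum_l inner_sq (e k) (g l) * (c l - c k) ^+ 2 == 0.
    under eq_bigr do rewrite varE.
    rewrite sumrB exchange_big /= subr_eq0; apply/eqP/eq_bigr => l _.
    by rewrite -mulr_suml pcol mul1r.
  rewrite psumr_eq0 => [/allP ksum|k _]; last exact: sumr_ge0.
  move=> k l clk; have := ksum k; rewrite mem_index_enum => /(_ isT).
  rewrite psumr_eq0 // => /allP/(_ l); rewrite mem_index_enum => /(_ isT).
  by rewrite mulf_eq0 sqrf_eq0 subr_eq0 (negbTE clk) orbF => /eqP/inner_sq_eq0.
exists e => // k l; split.
  by apply: sharp => // i; case: (rigid i).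
by apply: sharp => // i; case: (rigid i).
Qed.

End WeightedFrameOperator.

(** * Uniqueness of the operators selected by their defining properties *)

Section Operators.
Variables (R : realType) (H : hilbertType R).
Implicit Types (V W Z : set H) (x y z : H).

Lemma linear_funB (T : H -> H) x y : linear T -> T (x - y) = T x - T y.
Proof. by move=> linT; rewrite addrC -scaleN1r linT scaleN1r addrC. Qed.

Lemma linear_funZ (T : H -> H) a x : linear T -> T (a *: x) = a *: T x.
Proof.
move=> linT; have T0 : T 0 = 0 by rewrite -{1}(subrr x) linear_funB ?subrr.
by rewrite -[a *: x]addr0 linT T0 addr0.
Qed.

Lemma has_dim_leq V d d' : has_dim V d -> has_dim V d' -> (d <= d')%N.
Proof.
move=> [e free_e spe] [f _ spf].
have coord i : exists a : 'I_d' -> R[i], synthesis f a = e i.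
  have : lspan f (e i) by rewrite spf -spe; exact: lspan_gen.
  by move=> [a _ ae]; exists a.
have [a aE] := choice coord.
pose M : 'M[R[i]]_(d, d') := \matrix_(i, j) a i j.
have /eqP <- : row_free M; last exact: rank_leq_col.
apply: inj_row_free => v vM; apply/rowP => i; rewrite mxE.
apply: (free_e (v 0)); rewrite /synthesis.
under eq_bigr do rewrite -aE scaler_sumr.
rewrite exchange_big big1 // => j _.
have /matrixP/(_ 0 j) := vM; rewrite !mxE => vMj.
under eq_bigr do rewrite scalerA.
rewrite -scaler_suml (_ : \sum_i _ = 0) ?scale0r // -[RHS]vMj.
by apply: eq_bigr => k _; rewrite mxE.
Qed.

Lemma has_dim_unique V d d' : has_dim V d -> has_dim V d' -> d = d'.
Proof. by move=> h h'; apply/eqP; rewrite eqn_leq !(has_dim_leq (V := V)). Qed.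

Lemma sdimE V d : has_dim V d -> sdim V = d.
Proof.
move=> h; apply: (@has_dim_unique V) => //.
by rewrite /sdim; apply: (@getPex _ (has_dim V)); exists d.
Qed.

Lemma onb_has_dim V d (e : 'I_d -> H) : orthonormal_basis V e -> has_dim V d.
Proof. by move=> [on sp]; exists e => //; exact: orthonormal_lin_indep. Qed.

(** The multiplicity of each positive value is a dimension and no other value occurs; sorted lists
    with equal multiplicities are equal. *)
Lemma pos_eigenvalues_unique (A : H -> H) s s' :
  is_pos_eigenvalues A s -> is_pos_eigenvalues A s' -> s = s'.
Proof.
move=> [srt pos dim] [srt' pos' dim'].
apply: (sorted_eq (leT := >=%R)) => //; first exact: ge_trans.
  exact: ge_anti.
apply/allP => m _ /=; apply/eqP; have [m0|m0] := ltP 0 m.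
  exact: has_dim_unique (dim m m0) (dim' m m0).
have none t : {in t, forall mu : R, 0 < mu} -> count_mem m t = 0%N.
  move=> post; apply/count_memPn/negP => /post; rewrite ltNge m0 //.
by rewrite !none.
Qed.

Lemma wop_pos_eigenvalues d (e : 'I_d -> H) (mu : 'I_d -> R) :
  orthonormal_family e -> (forall k, 0 < mu k) ->
  is_pos_eigenvalues (wop mu e) (decreasing_rearrangement mu).
Proof.
move=> on mu0; have onb : orthonormal_basis (lspan e) e by [].
split=> [|m|m m0].
- by apply: sort_sorted => x y; exact: le_total.
- by rewrite mem_sort => /mapP[k _ ->].
pose K : {pred 'I_d} := [pred k | mu k == m].
have -> : count_mem m (decreasing_rearrangement mu) = #|K|.
  rewrite /decreasing_rearrangement (seq.permP (permEl (perm_sort _ _))) count_map.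
  by rewrite cardE enumT -size_filter; congr size; apply: eq_filter.
pose f (i : 'I_#|K|) := e (enum_val i).
have muf (i : 'I_#|K|) : mu (enum_val i) = m.
  by apply/eqP; have Ki := enum_valP i; exact: Ki.
have onf : orthonormal_family f.
  by move=> i j; rewrite on (inj_eq enum_val_inj).
have fe : lspan f `<=` lspan e by apply: lspan_sub => i; exact: lspan_gen.
exists f; first exact: orthonormal_lin_indep.
apply/seteqP; split=> [z fz|z Az].
  apply: wop_eigen onb (fe _ fz) _ => l lm.
  rewrite innerC (lspan_inner0 _ fz) ?rmorph0 // => i.
  rewrite on; case: eqP => // li; move: lm.
  by rewrite li muf eqxx.
(* As [m] is nonzero, [z] is a multiple of its own image. *)
have ez : lspan e z.
  have mC : m%:C != 0 by rewrite -[0]/(0%:C) (inj_eq (@complexI R)) gt_eqF.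
  by rewrite -[z](scalerK mC) -Az; apply/lspanZ/wop_lspan.
rewrite (onb_expansion onb ez); elim/big_ind: _ => [|x y|l _].
- exact: lspan0.
- exact: lspanD.
have [lm|lm] := eqVneq (mu l) m.
  have Kl : l \in K by rewrite inE lm.
  by rewrite -(enum_rankK_in Kl Kl); apply/lspanZ/(lspan_gen f).
suff -> : '[z, e l] = 0 by rewrite scale0r; exact: lspan0.
have : '[wop mu e z, e l] = '[m%:C *: z, e l] by rewrite Az.
rewrite wop_selfadjoint wop_orthonormal // innerZr conj_realC innerZl => /eqP.
rewrite -subr_eq0 -mulrBl mulf_eq0 subr_eq0 (inj_eq (@complexI R)) (negbTE lm).
by move/eqP.
Qed.

Lemma wop_eigenvalues d (e : 'I_d -> H) (mu : 'I_d -> R) i :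
  orthonormal_family e -> (forall k, 0 < mu k) ->
  eigenvalues (wop mu e) i = (decreasing_rearrangement mu)`_i.
Proof.
move=> on mu0; have P := wop_pos_eigenvalues on mu0.
rewrite /eigenvalues; congr (_`_i); apply: pos_eigenvalues_unique (P).
by apply: xgetPex; exists (decreasing_rearrangement mu).
Qed.

(** Self-adjointness together with a range inside [V] determines [T] on all of [H] from its values
    on the basis. *)
Lemma eigenbasis_wop V d (e : 'I_d -> H) (be : 'I_d -> R) (T : H -> H) :
  orthonormal_basis V e -> (forall x y, '[T x, y] = '[x, T y]) ->
  (forall x, V (T x)) -> (forall k, T (e k) = (be k)%:C *: e k) -> T = wop be e.
Proof.
move=> onb herm TV Te; apply/funext => z; apply: (onb_inner_ext onb) => // [|k].
  by rewrite -onb.2; exact: wop_lspan.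
by rewrite herm wop_selfadjoint Te wop_orthonormal //; case: onb.
Qed.

Lemma wop_comp d (e : 'I_d -> H) (a b : 'I_d -> R) z : orthonormal_family e ->
  wop a e (wop b e z) = wop (fun k => a k * b k) e z.
Proof.
move=> on; apply: eq_bigr => k _.
rewrite wop_selfadjoint wop_orthonormal // innerZr conj_realC.
by rewrite mulrA [in RHS]rmorphM.
Qed.

Lemma adjointE (A B : H -> H) : is_adjoint A B -> adjoint A = B.
Proof.
move=> AB; have [_ adj] : is_adjoint A (adjoint A).
  by apply: (@getPex _ (is_adjoint A)); exists B.
apply/funext => y; apply: inner_ext => x.
by rewrite innerC -adj AB.2 -innerC.
Qed.

Lemma wop_adjoint n (b : 'I_n -> R) (g : 'I_n -> H) : is_adjoint (wop b g) (wop b g).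
Proof. by split; [exact: wop_linear|exact: wop_selfadjoint]. Qed.

Lemma oblique_projE V Z T : is_oblique_proj V Z T -> oblique_proj V Z = T.
Proof.
move=> PT; have [lin' idem' ran' ker'] : is_oblique_proj V Z (oblique_proj V Z).
  by apply: (@getPex _ (is_oblique_proj V Z)); exists T.
have [lin idem ran ker] := PT; apply/funext => x.
have VTx : V (T x) by rewrite -ran; exists x.
have [y _ yE] : range (oblique_proj V Z) (T x) by rewrite ran'.
have gT : oblique_proj V Z (T x) = T x.
  by rewrite -yE -[in LHS]/((_ \o oblique_proj V Z) y) idem'.
have ZxT : Z (x - T x).
  by rewrite -ker /= linear_funB // -[T (T x)]/((T \o T) x) idem subrr.
have : (oblique_proj V Z @^-1` [set 0]) (x - T x) by rewrite ker'.
rewrite /= linear_funB // gT => /eqP.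
by rewrite subr_eq0 => /eqP.
Qed.

Lemma wop1_id V d (e : 'I_d -> H) z : orthonormal_basis V e -> V z ->
  wop (fun=> 1) e z = z.
Proof.
move=> onb Vz; rewrite (wop_eigen (c := 1) onb Vz) ?scale1r // => l.
by rewrite eqxx.
Qed.

Lemma wop1_inner V d (e : 'I_d -> H) x z : orthonormal_basis V e -> V z ->
  '[wop (fun=> 1) e x, z] = '[x, z].
Proof. by move=> onb Vz; rewrite wop_selfadjoint (wop1_id onb Vz). Qed.

Lemma orth_projE V d (e : 'I_d -> H) :
  orthonormal_basis V e -> orth_proj V = wop (fun=> 1) e.
Proof.
move=> onb; have TV x : V (wop (fun=> 1) e x) by rewrite -onb.2; exact: wop_lspan.
apply: oblique_projE; split; first exact: wop_linear.
- by apply/funext => x /=; rewrite (wop1_id onb).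
- apply/seteqP; split=> [_ [x _ <-] //|v Vv].
  by exists v => //; rewrite (wop1_id onb).
apply/seteqP; split=> [x /= Tx v Vv|x xV /=].
  by rewrite -(wop1_inner x onb Vv) Tx inner0l.
by apply: inner_self_eq0; rewrite (wop1_inner _ onb) ?xV.
Qed.

(** Self-adjointness of the four products yields [S X = S Y] and [X S = Y S], whence
    [X = X S X = Y S Y = Y]. *)
Lemma pinv_unique (S X Y : H -> H) : is_pinv S X -> is_pinv S Y -> X = Y.
Proof.
move=> [lX SXS XSX [_ aSX] [_ aXS]] [lY SYS YSY [_ aSY] [_ aYS]].
have eSXS z : S (X (S z)) = S z by rewrite -[RHS]/(S z) -[in RHS]SXS.
have eSYS z : S (Y (S z)) = S z by rewrite -[in RHS]SYS.
have eXSX z : X (S (X z)) = X z by rewrite -[in RHS]XSX.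
have eYSY z : Y (S (Y z)) = Y z by rewrite -[in RHS]YSY.
have SXY z : S (X z) = S (Y z).
  apply: inner_ext => t; have := aSX z t; rewrite /= => ->.
  rewrite -{1}(eSYS (X t)); have := aSY z (S (X t)); rewrite /= => <-.
  by have := aSX (S (Y z)) t; rewrite /= => <-; rewrite eSXS.
have XSY z : X (S z) = Y (S z).
  apply: inner_ext => t; rewrite -{1}(eSYS z).
  have := aXS (Y (S z)) t; rewrite /= => ->.
  have := aYS z (X (S t)); rewrite /= => ->.
  by rewrite eSXS; have := aYS z t; rewrite /= => ->.
by apply/funext => z; rewrite -eXSX XSY SXY eYSY.
Qed.

Lemma pinv_wop d (e : 'I_d -> H) (mu : 'I_d -> R) :
  orthonormal_family e -> (forall k, mu k != 0) ->
  Defs.pinv (wop mu e) = wop (fun k => (mu k)^-1) e.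
Proof.
move=> on mu0.
have SX : wop mu e \o wop (fun k => (mu k)^-1) e = wop (fun=> 1) e.
  apply/funext => z /=; rewrite wop_comp //; congr (wop _ e z).
  by apply/funext => k; rewrite mulfV.
have XS : wop (fun k => (mu k)^-1) e \o wop mu e = wop (fun=> 1) e.
  apply/funext => z /=; rewrite wop_comp //; congr (wop _ e z).
  by apply/funext => k; rewrite mulVf.
have one b : wop (fun=> 1) e \o wop b e = wop b e.
  apply/funext => z /=; rewrite wop_comp //; congr (wop _ e z).
  by apply/funext => k; rewrite mul1r.
have P : is_pinv (wop mu e) (wop (fun k => (mu k)^-1) e).
  by split; rewrite ?SX ?XS ?one //; [exact: wop_linear|exact: wop_adjoint|exact: wop_adjoint].
apply: (pinv_unique _ P); apply: (@getPex _ (is_pinv (wop mu e))).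
by exists (wop (fun k => (mu k)^-1) e).
Qed.

Lemma modulus_exists (T : H -> H) d (e : 'I_d -> H) (tau : 'I_d -> R) :
  orthonormal_family e -> (forall k, 0 <= tau k) -> adjoint T \o T = wop tau e ->
  is_modulus T (modulus T).
Proof.
move=> on tau0 TT; apply: (@getPex _ (is_modulus T)).
exists (wop (fun k => Num.sqrt (tau k)) e); split; last first.
  rewrite TT; apply/funext => z /=; rewrite wop_comp //; congr (wop _ e z).
  by apply/funext => k; rewrite -expr2 sqr_sqrtr.
split; first exact: wop_linear.
move=> x; rewrite wop_quad -[0]/(0%:C) lecR; apply: sumr_ge0 => k _.
by rewrite mulr_ge0 ?sqrtr_ge0 ?inner_sq_ge0.
Qed.

(** If [M^2 z = c^2 z], then [u = M z - c z] satisfies [M u = - c u], which positivity of [M] allows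
    only for [u = 0]. The defining property of the modulus thus suffices, without uniqueness of
    square roots. *)
Lemma modulus_eigen (T M : H -> H) (c : R) z : is_modulus T M -> 0 < c ->
  M z = c%:C *: z <-> adjoint T (T z) = (c ^+ 2)%:C *: z.
Proof.
move=> [[linM posM] MM] c0.
have MME y : adjoint T (T y) = M (M y) by rewrite -[RHS]/((M \o M) y) MM.
have cc : (c ^+ 2)%:C = c%:C * c%:C by rewrite expr2 [LHS]rmorphM.
rewrite MME; split=> [Mz|MMz]; first by rewrite Mz linear_funZ // Mz scalerA cc.
pose u := M z - c%:C *: z.
have Mu : M u = - (c%:C *: u).
  by rewrite {1}/u linear_funB // linear_funZ // MMz cc /u scalerBr scalerA opprB.
apply/eqP; rewrite -subr_eq0 -/u; apply/eqP/inner_self_eq0.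
have := posM u; rewrite Mu -scaleNr innerZl mulNr oppr_ge0 => le0.
have cC : 0 < c%:C by rewrite -[0]/(0%:C) ltcR.
apply/eqP; rewrite eq_le inner_self_ge0 andbT.
by rewrite -(pmulr_rle0 _ cC).
Qed.

End Operators.

(** * Oblique projections and principal vectors *)

Section ObliqueDuals.
Variables (R : realType) (H : hilbertType R).
Implicit Types (V W Z : set H) (x y z : H).

Lemma linear_fun_synthesis (T : H -> H) n (g : 'I_n -> H) a : linear T ->
  T (synthesis g a) = synthesis (T \o g) a.
Proof.
move=> linT; have T0 : T 0 = 0 by rewrite -[X in T X](subrr 0) linear_funB // subrr.
have TD x y : T (x + y) = T x + T y by rewrite -[x]scale1r linT !scale1r.
rewrite /synthesis (big_morph T TD T0); apply: eq_bigr => i _.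
exact: linear_funZ.
Qed.

Lemma frame_op_wop n (F : 'I_n -> H) : frame_op F = wop (fun=> 1) F.
Proof.
by apply/funext => z; apply: eq_bigr => i _; rewrite [1%:C]rmorph1 mul1r.
Qed.

Lemma is_adjoint_sym (A B : H -> H) x y : is_adjoint A B -> '[B x, y] = '[x, A y].
Proof. by move=> [_ AB]; rewrite innerC -AB -innerC. Qed.

Lemma is_adjoint_comp (A A' B B' : H -> H) :
  is_adjoint A A' -> is_adjoint B B' -> is_adjoint (A \o B) (B' \o A').
Proof.
move=> [lA AA] [lB BB]; split=> [a x y|x y]; first by rewrite /= lA lB.
by rewrite /= AA BB.
Qed.

Lemma wop_conj n (b : 'I_n -> R) (g : 'I_n -> H) (L L' : H -> H) z :
  linear L -> is_adjoint L L' -> L (wop b g (L' z)) = wop b (L \o g) z.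
Proof.
move=> linL adj.
rewrite /wop -[\sum_k _]/(synthesis g (fun k => (b k)%:C * '[L' z, g k])).
rewrite linear_fun_synthesis //; apply: eq_bigr => k _.
by rewrite (is_adjoint_sym _ _ adj).
Qed.

Lemma inner_sqZr (c : R) x y :
  inner_sq x (c%:C *: y) = c ^+ 2 * inner_sq x y.
Proof.
apply: complexI; rewrite inner_sqE innerZl innerZr conj_realC.
by rewrite [RHS]rmorphM rmorphXn /= inner_sqE; ring.
Qed.

Lemma oblique_proj_exists V W m (e : 'I_m -> H) : lspan e = V ->
  direct_sum V (orthocompl W) -> exists Q, is_oblique_proj V (orthocompl W) Q.
Proof.
move=> spV [sumT cap0].
have dec x : exists v, V v /\ orthocompl W (x - v).
  have : [set v + z | v in V & z in orthocompl W] x by rewrite sumT.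
  by move=> [v Vv [z Zz <-]]; exists v; rewrite addrAC subrr add0r.
have [Q QP] := choice dec.
have uniq v v' x : V v -> V v' -> orthocompl W (x - v) -> orthocompl W (x - v') -> v = v'.
  move=> Vv Vv' Zv Zv'; apply/eqP; rewrite -subr_eq0.
  suff : [set (0 : H)] (v - v') by move=> /= ->.
  rewrite -cap0; split; first by rewrite -spV; apply: lspanB; rewrite spV.
  move=> w Ww; have := Zv w Ww; have := Zv' w Ww; rewrite !innerBl => /eqP.
  by rewrite subr_eq0 => /eqP -> /eqP; rewrite subr_eq0 => /eqP ->; rewrite subrr.
have Qid v : V v -> Q v = v.
  move=> Vv; have [VQ ZQ] := QP v; apply: (uniq _ _ v) => //.
  by move=> w _; rewrite subrr inner0l.
exists Q; split.
- move=> a x y; have [VQ ZQ] := QP (a *: x + y).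
  apply: (uniq _ _ (a *: x + y)) => //.
    rewrite -spV; apply: lspanD; [apply: lspanZ|]; rewrite spV.
      exact: (QP x).1.
    exact: (QP y).1.
  move=> w Ww; rewrite opprD addrACA -scalerBr innerDl innerZl.
  by rewrite (QP x).2 // (QP y).2 // mulr0 addr0.
- by apply/funext => x /=; rewrite Qid //; case: (QP x).
- apply/seteqP; split=> [_ [x _ <-]|v Vv]; first by case: (QP x).
  by exists v => //; exact: Qid.
apply/seteqP; split=> [x /= Qx|x Zx /=].
  by have := (QP x).2; rewrite Qx subr0.
have [VQ ZQ] := QP x; apply: (uniq _ _ x) => //; last by rewrite subr0.
by rewrite -spV; exact: lspan0.
Qed.

Section ObliqueProjection.
Variables (V W : set H) (d : nat) (w : 'I_d -> H) (Q : H -> H).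
Hypotheses (onbw : orthonormal_basis W w) (PQ : is_oblique_proj V (orthocompl W) Q).

Let linQ : linear Q. Proof. by case: PQ. Qed.

Lemma oblique_mem x : V (Q x).
Proof. by case: PQ => _ _ <- _; exists x. Qed.

Lemma oblique_id v : V v -> Q v = v.
Proof.
case: PQ => _ idem <- _ [x _ <-].
by rewrite -[LHS]/((Q \o Q) x) idem.
Qed.

Lemma oblique_ker x : orthocompl W x -> Q x = 0.
Proof. by case: PQ => _ _ _ <-. Qed.

(** [Q x - x] lies in the kernel of [Q], which is the orthocomplement of [W]. *)
Lemma oblique_inner x z : W z -> '[Q x, z] = '[x, z].
Proof.
move=> Wz; have : orthocompl W (Q x - x).
  case: PQ => _ _ _ <- /=.
  by rewrite linear_funB // (oblique_id (oblique_mem x)) subrr.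
by move/(_ z Wz)/eqP; rewrite innerBl subr_eq0 => /eqP.
Qed.

Lemma oblique_inner_r x z : W z -> '[z, Q x] = '[z, x].
Proof. by move=> Wz; rewrite innerC oblique_inner // -innerC. Qed.

Lemma oblique_expansion x : Q x = synthesis (Q \o w) (fun k => '[x, w k]).
Proof.
rewrite -linear_fun_synthesis //; apply/eqP; rewrite -subr_eq0 -linear_funB //.
apply/eqP/oblique_ker => z; rewrite -onbw.2.
apply: lspan_inner0 => k.
by rewrite innerBl orthonormal_synthesis ?subrr //; case: onbw.
Qed.

Definition oblique_adjoint z : H := synthesis w (fun k => '[z, Q (w k)]).

Lemma oblique_adjointP : is_adjoint Q oblique_adjoint.
Proof.
split=> [a x y|x y].
  rewrite /oblique_adjoint /synthesis scaler_sumr -big_split.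
  by apply: eq_bigr => k _; rewrite innerDl innerZl scalerDl scalerA.
rewrite oblique_expansion inner_suml inner_sumr; apply: eq_bigr => k _.
by rewrite innerZl innerZr -innerC mulrC.
Qed.

(** Diagonalize the adjoint of [Q] composed with [Q], whose range lies in [W]. The eigenvalue
    [tau k] is the squared norm of [Q (e k)]; if it vanished, [e k] would be orthogonal to itself by
    [oblique_inner]. *)
Lemma oblique_gram : exists e (tau : 'I_d -> R),
  [/\ orthonormal_basis W e, forall k, 0 < tau k &
      forall x z, '[Q x, Q z] = '[wop tau e x, z]].
Proof.
pose T := oblique_adjoint \o Q.
have TE x z : '[T x, z] = '[Q x, Q z] by exact: is_adjoint_sym oblique_adjointP.
have linT : linear T.
  by move=> a x y; rewrite /T /= linQ; case: oblique_adjointP => ->.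
have hermT x z : '[T x, z] = '[x, T z].
  by rewrite TE innerC -TE -innerC.
have TW x : W (T x) by rewrite -onbw.2; exists (fun k => '[Q x, Q (w k)]).
have [e [tau [onbe _ Te]]] := spectral_onb onbw linT hermT (fun x _ => TW x).
exists e, tau; split=> // [k|x z]; last by rewrite -TE (eigenbasis_wop onbe hermT TW Te).
have tauE : (tau k)%:C = '[Q (e k), Q (e k)].
  by rewrite -TE Te innerZl onbe.1 eqxx mulr1.
have : 0 <= (tau k)%:C by rewrite tauE inner_self_ge0.
rewrite -[0]/(0%:C) lecR le_eqVlt => /predU1P[t0|//].
have Qe0 : Q (e k) = 0 by apply: inner_self_eq0; rewrite -tauE -t0.
have := onbe.1 k k; rewrite eqxx -(oblique_inner _ (onb_mem onbe k)) Qe0 inner0l.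
by move/eqP; rewrite eq_sym oner_eq0.
Qed.

Lemma oblique_onb (a : 'I_d -> R) : (forall k, 0 < a k) ->
  (forall j k, '[Q (w j), Q (w k)] = (a j)%:C * (j == k)%:R) ->
  orthonormal_basis V (fun k => (Num.sqrt (a k))^-1%:C *: Q (w k)).
Proof.
move=> a0 gram; have s0 k : Num.sqrt (a k) != 0 by rewrite gt_eqF // sqrtr_gt0.
split=> [j k|].
  rewrite innerZl innerZr gram conj_realC; case: eqP => [<-|_]; last by rewrite !mulr0.
  rewrite mulr1 -!rmorphM -[RHS]/((1 : R)%:C); congr (_%:C).
  by rewrite -[X in _ * (_ * X)]sqr_sqrtr ?ltW //; field.
apply/seteqP; split=> [x|v Vv].
  move=> [c _ <-]; rewrite (_ : synthesis _ c = Q (synthesis w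
      (fun k => c k * (Num.sqrt (a k))^-1%:C))); first exact: oblique_mem.
  rewrite linear_fun_synthesis //; apply: eq_bigr => k _ /=.
  by rewrite scalerA.
rewrite -(oblique_id Vv) oblique_expansion.
exists (fun k => '[v, w k] * (Num.sqrt (a k))%:C) => //.
apply: eq_bigr => k _ /=; rewrite scalerA -mulrA -rmorphM mulfV //.
by rewrite rmorph1 mulr1.
Qed.

End ObliqueProjection.

End ObliqueDuals.

Section PrincipalVectors.
Variables (R : realType) (H : hilbertType R) (V W : set H) (d : nat) (Q : H -> H).
Hypothesis PQ : is_oblique_proj V (orthocompl W) Q.
Implicit Types (w e y : 'I_d -> H) (a c : 'I_d -> R).

Local Notation T := (orth_proj V \o orth_proj W).

(** On [W] this operator inverts the adjoint of [Q] composed with [Q]: the normalized vectors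
    [Q (e k)] form an orthonormal basis of [V], and they project back onto [W] as [e k] divided by
    the square root of [a k]. *)
Lemma gram_compression e a : orthonormal_basis W e -> (forall k, 0 < a k) ->
  (forall j k, '[Q (e j), Q (e k)] = (a j)%:C * (j == k)%:R) ->
  adjoint T \o T = wop (fun k => (a k)^-1) e.
Proof.
move=> onbe a0 gram; have onbu := oblique_onb onbe PQ a0 gram.
set u := (fun k => _) in onbu.
have adj := is_adjoint_comp (wop_adjoint (fun=> 1) u) (wop_adjoint (fun=> 1) e).
rewrite (orth_projE onbu) (orth_projE onbe) (adjointE adj).
apply/funext => z /=; apply: inner_ext => y.
rewrite wop_selfadjoint (wop1_id onbu); last by rewrite -onbu.2; exact: wop_lspan.
rewrite wop_inner wop_inner; apply: eq_bigr => k _.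
have ue x : '[wop (fun=> 1) e x, u k] = ((Num.sqrt (a k))^-1)%:C * '[x, e k].
  rewrite innerZr conj_realC (oblique_inner_r PQ).
    by rewrite (wop1_inner x onbe) //; exact: (onb_mem onbe).
  by rewrite -onbe.2; exact: wop_lspan.
have eu x : '[u k, wop (fun=> 1) e x] = ((Num.sqrt (a k))^-1)%:C * '[e k, x].
  by rewrite innerC ue rmorphM /= conj_realC -innerC.
rewrite ue eu [1%:C]rmorph1 mul1r.
rewrite mulrACA -rmorphM; congr (_%:C * _).
by rewrite -invfM -expr2 sqr_sqrtr // ltW.
Qed.

(** An auxiliary eigenbasis [e] shows that the Gram operator inverts the compression; applying this
    to [w j] gives the reciprocal eigenvalue even when [w] differs from [e]. *)
Lemma compression_gram w c : orthonormal_basis W w -> (forall k, 0 < c k) ->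
  (forall k, adjoint T (T (w k)) = (c k ^+ 2)%:C *: w k) ->
  forall j k, '[Q (w j), Q (w k)] = ((c j ^+ 2)^-1)%:C * (j == k)%:R.
Proof.
move=> onbw c0 Kw j k.
have [e [tau [onbe tau0 gram]]] := oblique_gram onbw PQ.
have gram_e i l : '[Q (e i), Q (e l)] = (tau i)%:C * (i == l)%:R.
  by rewrite gram wop_orthonormal ?innerZl ?onbe.1 //; exact: onbe.1.
have KE := gram_compression onbe tau0 gram_e.
have c2 : (c j ^+ 2)%:C != 0.
  by rewrite -[0]/(0%:C) (inj_eq (@complexI R)) sqrf_eq0 gt_eqF.
have c2R : c j ^+ 2 != 0 by rewrite sqrf_eq0 gt_eqF.
apply: (mulfI c2); rewrite mulrA -rmorphM mulfV // rmorph1 mul1r.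
rewrite -innerZl -linear_funZ; last by case: PQ.
rewrite -Kw gram -[adjoint T (T (w j))]/((adjoint T \o T) (w j)) KE.
rewrite wop_comp; last exact: onbe.1.
rewrite (_ : (fun k => _) = fun=> 1); last first.
  by apply/funext => i; rewrite mulfV // gt_eqF.
by rewrite (wop1_id onbe) ?onbw.1 //; exact: (onb_mem onbw).
Qed.

(** Squaring the modulus turns principal vectors into eigenvectors of an explicit operator; positive
    cosines make this reversible. *)
Lemma principal_vectorsP (theta : 'I_d -> R) w : (forall k, 0 < cos (theta k)) ->
  principal_vectors V W theta w <-> orthonormal_basis W w /\
    forall k, adjoint T (T (w k)) = (cos (theta k) ^+ 2)%:C *: w k.
Proof.
move=> c0; split=> -[onbw prin]; (split=> // k).
all: have [e [tau [onbe tau0 gram]]] := oblique_gram onbw PQ.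
all: have gram_e i l : '[Q (e i), Q (e l)] = (tau i)%:C * (i == l)%:R
  by rewrite gram wop_orthonormal ?innerZl ?onbe.1 //; exact: onbe.1.
all: have tau0' i : 0 <= (tau i)^-1 by rewrite invr_ge0 ltW.
all: have M := modulus_exists onbe.1 tau0' (gram_compression onbe tau0 gram_e).
- by apply/(modulus_eigen _ M (c0 k)); exact: prin.
- by apply/(modulus_eigen _ M (c0 k)); exact: prin.
Qed.

End PrincipalVectors.

(** * Canonical oblique duals *)

Section DualFrames.
Variables (R : realType) (H : hilbertType R) (V W : set H) (d : nat) (Q : H -> H).
Hypothesis PQ : is_oblique_proj V (orthocompl W) Q.

Section Dual.
Variables (n : nat) (F : 'I_n -> H) (y : 'I_d -> H) (lam : 'I_d -> R).
Hypotheses (onby : orthonormal_basis W y) (lam0 : forall k, 0 < lam k).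
Hypothesis frame_opE : frame_op F = wop lam y.

Let G := canonical_dual V W F.

(** The dual is the image of [F] under [L], the map [Q] after the pseudo-inverse of the frame
    operator [S]. Its frame operator is [L S] times the adjoint of [L], where two of the three
    weights cancel. *)
Lemma dual_frame_op : frame_op G = wop (fun k => (lam k)^-1) (Q \o y).
Proof.
have linQ : linear Q by case: PQ.
have lamN0 k : lam k != 0 by rewrite gt_eqF.
have GE : G = (Q \o wop (fun k => (lam k)^-1) y) \o F.
  by rewrite /G /canonical_dual (oblique_projE PQ) frame_opE pinv_wop //; case: onby.
have adjQ := oblique_adjointP onby PQ.
have adj := is_adjoint_comp adjQ (wop_adjoint (fun k => (lam k)^-1) y).
have linL : linear (Q \o wop (fun k => (lam k)^-1) y).
  by move=> a u v; rewrite /= wop_linear linQ.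
apply/funext => z; rewrite frame_op_wop GE -(wop_conj _ _ _ linL adj) /=.
rewrite -frame_op_wop frame_opE -(wop_conj _ _ _ linQ adjQ); congr (Q _).
rewrite !wop_comp; try exact: onby.1.
by congr (wop _ y _); apply/funext => k; rewrite mulVf ?mul1r // mulrC mulfVK.
Qed.

(** A zero eigenvalue would give a unit vector of [V] orthogonal to all [Q (y j)], which span [V].
    Hence the dual spans [V], and its potential runs over exactly these [d] eigenvalues. *)
Lemma dual_spectrum : exists u (mu : 'I_d -> R),
  [/\ orthonormal_basis V u, antitone mu, forall k, 0 < mu k,
      wop (fun k => (lam k)^-1) (Q \o y) = wop mu u &
      forall h, potential h G = \sum_k h (mu k)].
Proof.
have linQ : linear Q by case: PQ.
have [e [tau [onbe tau0 gram]]] := oblique_gram onby PQ.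
have gram_e i l : '[Q (e i), Q (e l)] = (tau i)%:C * (i == l)%:R.
  by rewrite gram wop_orthonormal ?innerZl ?onbe.1 //; exact: onbe.1.
have onbv := oblique_onb onbe PQ tau0 gram_e.
set S := wop _ _.
have SV x : V (S x).
  rewrite -onbv.2; apply: lspan_sub (wop_lspan _ _ _) => i.
  by rewrite onbv.2; exact: (oblique_mem PQ).
have linS : linear S := wop_linear _ _.
have hermS : forall x z, '[S x, z] = '[x, S z] := wop_selfadjoint _ _.
have [u [mu [onbu anti Su]]] := spectral_onb onbv linS hermS (fun x _ => SV x).
have SE := eigenbasis_wop onbu hermS SV Su.
have mu_quad k : mu k = \sum_j (lam j)^-1 * inner_sq (u k) (Q (y j)).
  apply: complexI; rewrite -(wop_quad _ (Q \o y)) -/S Su innerZl onbu.1 eqxx.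
  by rewrite mulr1.
have term0 k j : 0 <= (lam j)^-1 * inner_sq (u k) (Q (y j)).
  by rewrite mulr_ge0 ?inner_sq_ge0 // invr_ge0 ltW.
have mu0 k : 0 < mu k.
  rewrite lt_def mu_quad sumr_ge0 // andbT psumr_eq0 //; apply/negP => /allP z0.
  have uQ j : '[u k, (Q \o y) j] = 0.
    have := z0 j; rewrite mem_index_enum => /(_ isT).
    by rewrite mulf_eq0 invr_eq0 gt_eqF //= => /eqP/inner_sq_eq0.
  have Vu := onb_mem onbu k.
  have : lspan (Q \o y) (u k).
    rewrite -(oblique_id PQ Vu) (oblique_expansion onby PQ).
    by exists (fun j => '[u k, y j]).
  move/(lspan_inner0 uQ); rewrite onbu.1 eqxx => /eqP.
  by rewrite oner_eq0.
exists u, mu; split=> // h.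
have spG : lspan G = V.
  apply/seteqP; split.
    rewrite -onbv.2; apply: lspan_sub => i; rewrite onbv.2 /G /canonical_dual.
    by rewrite (oblique_projE PQ) /=; exact: (oblique_mem PQ).
  rewrite -onbu.2; apply: lspan_sub => k.
  have muC : (mu k)%:C != 0.
    by rewrite -[0]/(0%:C) (inj_eq (@complexI R)) gt_eqF.
  rewrite -[u k](scalerK muC) -Su /S -dual_frame_op frame_op_wop.
  exact/lspanZ/wop_lspan.
rewrite /potential spG (sdimE (onb_has_dim onbu)); apply: eq_bigr => k _.
rewrite dual_frame_op -/S SE wop_eigenvalues ?antitone_nth //; exact: onbu.1.
Qed.

End Dual.

Lemma unitary_frame_op n (F : 'I_n -> H) (x : 'I_d -> H) (lam : 'I_d -> R)
    (U : {linear H -> H}) : unitary U -> frame_op F = wop lam x ->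
  frame_op (U \o F) = wop lam (U \o x).
Proof.
move=> [_ [B [adj BU UB]]] FE; apply/funext => z.
have linU : linear U by exact: linearP.
rewrite frame_op_wop -(wop_conj _ _ _ linU adj) -frame_op_wop FE.
exact: (wop_conj _ _ _ linU adj).
Qed.

Lemma unitary_inner (U : {linear H -> H}) x z : unitary U -> '[U x, U z] = '[x, z].
Proof.
move=> [_ [B [[_ adj] BU _]]].
by rewrite adj -[B (U z)]/((B \o U) z) BU.
Qed.

Lemma linear_image_lspan (U : {linear H -> H}) m (g : 'I_m -> H) :
  U @` lspan g = lspan (U \o g).
Proof.
have linU : linear U by exact: linearP.
apply/seteqP; split=> [_ [_ [a _ <-] <-]|_ [a _ <-]].
  by rewrite linear_fun_synthesis //; exists a.
by exists (synthesis g a); [exists a|rewrite linear_fun_synthesis].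
Qed.

Lemma unitary_onb (U : {linear H -> H}) (x : 'I_d -> H) : unitary U ->
  orthonormal_basis W x -> orthonormal_basis (U @` W) (U \o x).
Proof.
move=> unU [on sp]; split=> [i j|]; first by rewrite /= unitary_inner.
by rewrite -sp linear_image_lspan.
Qed.

(** Positivity comes from spanning: an eigenvector with eigenvalue zero would be orthogonal to every
    [F i], hence to itself. *)
Lemma frame_spectrum n (F : 'I_n -> H) (x : 'I_d -> H) (lam : 'I_d -> R) :
  is_frame W F -> orthonormal_basis W x ->
  (forall k, frame_op F (x k) = (lam k)%:C *: x k) ->
  frame_op F = wop lam x /\ forall k, 0 < lam k.
Proof.
move=> frF onbx Fx; have hermF : forall u v, '[frame_op F u, v] = '[u, frame_op F v].
  by rewrite frame_op_wop; exact: wop_selfadjoint.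
have FW u : W (frame_op F u) by rewrite -frF frame_op_wop; exact: wop_lspan.
split=> [|k]; first exact: eigenbasis_wop onbx hermF FW Fx.
have lamE : lam k = \sum_i 1 * inner_sq (x k) (F i).
  apply: complexI; rewrite -wop_quad -frame_op_wop Fx innerZl onbx.1 eqxx.
  by rewrite mulr1.
have term0 i : 0 <= 1 * inner_sq (x k) (F i) by rewrite mul1r inner_sq_ge0.
rewrite lt_def lamE sumr_ge0 // andbT psumr_eq0 //; apply/negP => /allP z0.
have xF i : '[x k, F i] = 0.
  have := z0 i; rewrite mem_index_enum => /(_ isT).
  by rewrite mul1r => /eqP/inner_sq_eq0.
have := lspan_inner0 xF (z := x k); rewrite frF onbx.1 eqxx => /(_ (onb_mem onbx k))/eqP.
by rewrite oner_eq0.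
Qed.

End DualFrames.

(** * Majorization of the spectra of the duals *)

Section OptimalDuals.
Variables (R : realType) (H : hilbertType R) (V W : set H) (d : nat) (Q : H -> H).
Hypothesis PQ : is_oblique_proj V (orthocompl W) Q.
Variables (w y : 'I_d -> H) (a b : 'I_d -> R).
Hypotheses (onbw : orthonormal_basis W w) (onby : orthonormal_basis W y).
Hypotheses (a0 : forall k, 0 < a k) (anti_a : antitone (fun k => - a k)).
Hypothesis anti_b : antitone b.
Hypothesis gram : forall j k, '[Q (w j), Q (w k)] = (a j)%:C * (j == k)%:R.
Variables (u : 'I_d -> H) (mu : 'I_d -> R).
Hypotheses (onbu : orthonormal_basis V u) (dualE : wop b (Q \o y) = wop mu u).

Let onbg := oblique_onb onbw PQ a0 gram.
Let g := fun k => (Num.sqrt (a k))^-1%:C *: Q (w k).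

Let quad_b z : W z -> \sum_k b k * inner_sq z (y k) = \sum_k mu k * inner_sq z (u k).
Proof.
move=> Wz; apply: complexI; rewrite -[RHS]wop_quad -dualE wop_quad.
congr (_%:C); apply: eq_bigr => k _; congr (_ * _); apply: complexI.
by rewrite !inner_sqE /= (oblique_inner PQ) // (oblique_inner_r PQ).
Qed.

Let inner_sq_g z k : W z -> inner_sq z (g k) = (a k)^-1 * inner_sq z (w k).
Proof.
move=> Wz; rewrite inner_sqZr exprVn sqr_sqrtr ?(ltW (a0 k)) //; congr (_ * _).
by apply: complexI; rewrite !inner_sqE (oblique_inner PQ) // (oblique_inner_r PQ).
Qed.

(** Both sides are the squared norm of the projection of [z] onto [V], computed in the bases [u] and
    [g]. *)
Let quad_u z : W z -> \sum_k inner_sq z (u k) = \sum_k (a k)^-1 * inner_sq z (w k).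
Proof.
move=> Wz; have <- : \sum_k 1 * inner_sq z (u k) = \sum_k inner_sq z (u k).
  by apply: eq_bigr => k _; rewrite mul1r.
apply: complexI; rewrite -wop_quad -(orth_projE onbu) (orth_projE onbg) wop_quad.
by congr (_%:C); apply: eq_bigr => k _; rewrite mul1r inner_sq_g.
Qed.

(** Parseval for [u i] in the basis [g], whose inner products with [V] are those of [w] rescaled. *)
Let trace_u i : \sum_k a k * inner_sq (w k) (u i) = 1.
Proof.
have [_ _ /(_ i) <-] := onb_doubly_stochastic onbg onbu.
apply: eq_bigr => k _; rewrite -/(g k).
have Vu := onb_mem onbu i; have Ww := onb_mem onbw k.
have -> : inner_sq (w k) (u i) = (a k)^-1 * inner_sq (g k) (u i); last first.
  by rewrite mulrA mulfV ?mul1r // gt_eqF.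
have e : '[w k, u i] = ((Num.sqrt (a k))^-1)%:C * '[g k, u i].
  rewrite -(wop1_inner (w k) onbg Vu) /wop (bigD1 k) //= big1 => [|j jk].
    rewrite addr0 innerZl [1%:C]rmorph1 mul1r; congr (_ * _).
    by rewrite innerZr conj_realC (oblique_inner_r PQ) // onbw.1 eqxx mulr1.
  rewrite innerZr (oblique_inner_r PQ) // onbw.1 eq_sym (negbTE jk).
  by rewrite !mulr0 scale0r.
have e' : '[u i, w k] = ((Num.sqrt (a k))^-1)%:C * '[u i, g k].
  by rewrite innerC e rmorphM /= conj_realC -innerC.
apply: complexI; rewrite [RHS]rmorphM /= !inner_sqE e e' mulrACA -rmorphM.
by rewrite -invfM -expr2 sqr_sqrtr // ltW.
Qed.

Lemma dual_truncated_trace t : 0 <= t ->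
  \sum_k Num.max (a k * b k) t <= \sum_k Num.max (mu k) t.
Proof.
exact: (truncated_trace_le onbw onby a0 anti_a anti_b quad_b quad_u trace_u).
Qed.

(** By [quad_b] and [trace_u], the sum of [mu] is the trace of the product of [wop a w] and
    [wop b y]; the hypothesis is thus the equality case of the trace inequality. *)
Lemma dual_trace_equality : \sum_k mu k = \sum_k a k * b k ->
  exists2 e, orthonormal_basis W e & forall k l,
    (a l != a k -> '[e k, w l] = 0) /\ (b l != b k -> '[e k, y l] = 0).
Proof.
move=> tr; apply: rearrangement_equality => //; rewrite -tr.
have -> : \sum_k a k * (\sum_l inner_sq (w k) (y l) * b l) =
    \sum_k \sum_i mu i * (a k * inner_sq (w k) (u i)).
  apply: eq_bigr => k _; under eq_bigr do rewrite mulrC.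
  rewrite quad_b ?mulr_sumr; last exact: (onb_mem onbw).
  by apply: eq_bigr => i _; rewrite mulrCA.
by rewrite exchange_big; apply: eq_bigr => i _ /=; rewrite -mulr_sumr trace_u mulr1.
Qed.

End OptimalDuals.

Theorem theorem4p5 (R : realType) (H : hilbertType R) (sepH : separable H)
    (V W : set H) (d : nat) (dimV : has_dim V d) (dimW : has_dim W d)
    (VW : direct_sum V (orthocompl W))
    (theta : 'I_d -> R) (angles : principal_angles V W theta)
    (theta_lt : forall j, theta j < pi / 2)
    (w : 'I_d -> H) (w_principal : principal_vectors V W theta w)
    (n : nat) (F : 'I_n -> H) (frameF : is_frame W F)
    (lam : nat -> R) (lamE : eigenvalues (frame_op F) = lam)
    (x : 'I_d -> H) (x_basis : orthonormal_basis W x)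
    (x_eigen : forall j : 'I_d, frame_op F (x j) = (lam j)%:C *: x j)
    (U0 : {linear H -> H}) (U0_unitary : unitary U0)
    (U0x : forall j, U0 (x j) = w (rev_ord j)) :
  (forall i : nat,
     eigenvalues (frame_op (canonical_dual V W (U0 \o F))) i =
     (decreasing_rearrangement
        (fun j : 'I_d => (cos (theta j)) ^- 2 * (lam (rev_ord j))^-1))`_i) /\
  (forall h : R -> R, Conv_ge0 h -> nondecreasing_ge0 h ->
     is_min (dual_potentials V W F h)
            (potential h (canonical_dual V W (U0 \o F))) /\
     (strictly_convex_ge0 h ->
      forall U : {linear H -> H}, unitary U -> U @` W = W ->
      is_min (dual_potentials V W F h)
             (potential h (canonical_dual V W (U \o F))) ->
      exists w' x' : 'I_d -> H,
        [/\ principal_vectors V W theta w',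
            orthonormal_basis W x',
            forall j : 'I_d, frame_op F (x' j) = (lam j)%:C *: x' j &
            forall j, U (x' j) = w' (rev_ord j)])).
Proof.
have linU (U : {linear H -> H}) : linear U by exact: linearP.
have [Q PQ] : exists Q, is_oblique_proj V (orthocompl W) Q.
  by case: dimV => e _ spV; exact: oblique_proj_exists spV VW.
have [frame_opF lam0] := frame_spectrum frameF x_basis x_eigen.
(* The first [d] terms of [lam] coincide with their own decreasing rearrangement. *)
have anti_lam : antitone (fun k : 'I_d => lam k).
  have [s [anti sE]] := antitone_sort (fun k : 'I_d => lam k).
  have lam_sort (k : 'I_d) : lam k = lam (s k).
    rewrite -{1}lamE frame_opF wop_eigenvalues ?sE //; last by case: x_basis.
    by rewrite (nth_map_enum_ord (fun k => lam (s k))).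
  by move=> i j ij; rewrite lam_sort [leRHS]lam_sort anti.
have [theta_itv theta_homo _] := angles.
have c0 k : 0 < cos (theta k).
  have /andP[t0 _] := theta_itv k; apply: cos_gt0_pihalf; rewrite theta_lt andbT.
  by apply: lt_le_trans t0; rewrite oppr_lt0 divr_gt0 ?pi_gt0.
pose a k := cos (theta k) ^- 2; pose b (k : 'I_d) := (lam (rev_ord k))^-1.
have a0 k : 0 < a k by rewrite invr_gt0 exprn_gt0.
have anti_a : antitone (fun k => - a k).
  move=> i j ij; rewrite lerN2 /a lef_pV2 ?posrE ?exprn_gt0 //.
  have mem k : theta k \in `[0, pi].
    have /andP[t0 t1] := theta_itv k; rewrite in_itv /= t0 (le_trans t1) //.
    by rewrite ler_pdivrMr // ler_peMr ?pi_ge0 // ler1n.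
  rewrite ler_pXn2r ?nnegrE ?(ltW (c0 _)) //.
  rewrite leNgt ltr_cos ?mem // -leNgt.
  exact: theta_homo.
have anti_b : antitone b.
  move=> i j ij; rewrite /b lef_pV2 ?posrE ?lam0 //; apply: anti_lam => /=.
  exact: leq_sub2l.
have b0 k : 0 < b k by rewrite invr_gt0 lam0.
have [onbw Kw] := (principal_vectorsP PQ _ c0).1 w_principal.
have gram : forall j k, '[Q (w j), Q (w k)] = (a j)%:C * (j == k)%:R :=
  compression_gram PQ onbw c0 Kw.
(* Reversing the order matches the decreasing [b] with the increasing [a]; for [U0] this basis is
   [w] itself. *)
pose y (U : H -> H) k := U (x (rev_ord k)).
have dualE (U : {linear H -> H}) :
    wop (fun k : 'I_d => (lam k)^-1) (Q \o (U \o x)) = wop b (Q \o y U).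
  by apply/funext => z; rewrite /wop (reindex_inj rev_ord_inj).
have onbU (U : {linear H -> H}) : unitary U -> U @` W = W ->
    orthonormal_basis W (U \o x) /\ orthonormal_basis W (y U).
  move=> unU UW; have onbUx := unitary_onb unU x_basis; rewrite UW in onbUx.
  by split=> //; exact: (onb_perm onbUx rev_ord_inj).
have U0W : U0 @` W = W.
  rewrite -[in LHS]x_basis.2 linear_image_lspan.
  have -> : U0 \o x = (fun k => w (rev_ord k)) by apply/funext => k /=; rewrite U0x.
  by case: (onb_perm onbw rev_ord_inj).
have spectrum0 i : eigenvalues (frame_op (canonical_dual V W (U0 \o F))) i =
    (decreasing_rearrangement (fun j : 'I_d => a j * b j))`_i.
  have [onbUx onbUy] := onbU U0 U0_unitary U0W.
  have FU := unitary_frame_op U0_unitary frame_opF.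
  rewrite (dual_frame_op PQ onbUx lam0 FU) dualE.
  have onbg := oblique_onb onbw PQ a0 gram; set g := (fun k => _) in onbg.
  (* [Q (w k)] is the unit vector [g k] times the square root of [a k], so each weight is multiplied
     by [a k]. *)
  have -> : wop b (Q \o y U0) = wop (fun k => a k * b k) g.
    apply/funext => z; apply: eq_bigr => k _.
    rewrite /y /= U0x rev_ordK innerZr conj_realC scalerA.
    have -> : (a k * b k)%:C = (Num.sqrt (a k))%:C * (Num.sqrt (a k))%:C * (b k)%:C.
      by rewrite -!rmorphM -expr2 sqr_sqrtr // ltW.
    congr (_ *: _).
    have sC : (Num.sqrt (a k))%:C * ((Num.sqrt (a k))^-1)%:C = 1.
      by rewrite -rmorphM mulfV ?rmorph1 // gt_eqF // sqrtr_gt0.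
    rewrite -[LHS]mul1r -[LHS]mul1r -{1 2}sC; ring.
  apply: wop_eigenvalues => [|k]; first by case: onbg.
  by rewrite mulr_gt0.
split=> // h cvx incr.
have [s [anti_z zE]] := antitone_sort (fun k : 'I_d => a k * b k).
pose z k := a (s k) * b (s k).
have potential_dual (U : {linear H -> H}) : unitary U -> U @` W = W ->
    exists u (mu : 'I_d -> R), [/\ orthonormal_basis V u, antitone mu,
      forall k, 0 < mu k, wop b (Q \o y U) = wop mu u &
      frame_op (canonical_dual V W (U \o F)) = wop mu u /\
      potential h (canonical_dual V W (U \o F)) = \sum_k h (mu k)].
  move=> unU UW; have [onbUx _] := onbU U unU UW.
  have FU := unitary_frame_op unU frame_opF.
  have [u [mu [onbu anti mu0 E pot]]] := dual_spectrum PQ onbUx lam0 FU.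
  exists u, mu; split=> //; first by rewrite -dualE.
  by split=> //; rewrite (dual_frame_op PQ onbUx lam0 FU).
have pot0 : potential h (canonical_dual V W (U0 \o F)) = \sum_k h (z k).
  have [u [mu [onbu anti mu0 _ [GE ->]]]] := potential_dual U0 U0_unitary U0W.
  apply: eq_bigr => k _; congr (h _).
  have := spectrum0 k; rewrite GE wop_eigenvalues //; last by case: onbu.
  by rewrite antitone_nth // => ->; rewrite zE (nth_map_enum_ord z).
have compare (U : {linear H -> H}) : unitary U -> U @` W = W ->
    \sum_k h (z k) <= potential h (canonical_dual V W (U \o F)) /\
    (strictly_convex_ge0 h ->
     potential h (canonical_dual V W (U \o F)) <= \sum_k h (z k) ->
     exists2 e, orthonormal_basis W e & forall k l,
       (a l != a k -> '[e k, w l] = 0) /\ (b l != b k -> '[e k, y U l] = 0)).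
  move=> unU UW; have [_ onby] := onbU U unU UW.
  have [u [mu [onbu anti mu0 E [_ ->]]]] := potential_dual U unU UW.
  have mu0' k : 0 <= mu k by rewrite ltW.
  have z0 k : 0 < z k by rewrite mulr_gt0.
  have maj t : 0 <= t -> \sum_k Num.max (z k) t <= \sum_k Num.max (mu k) t.
    (* A sum over all indices ignores the sorting permutation, which is undone to recover the order
       of [a] and [b]. *)
    move=> t0; rewrite (reindex_inj (@perm_inj _ s^-1)%g) /z.
    under eq_bigr do rewrite permKV.
    exact: (dual_truncated_trace PQ onbw onby a0 anti_a anti_b gram onbu E t0).
  have [le eq] := weak_majorization_convex cvx incr anti_z z0 mu0'
    (weak_majorization_heads anti mu0' maj).
  split=> // scvx ge; apply: (dual_trace_equality PQ onbw onby a0 anti_a anti_b gram onbu E).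
  rewrite (eq_bigr z) => [|k _]; last exact: eq scvx ge k.
  by rewrite [RHS](reindex_inj (@perm_inj _ s)).
split; first split.
- by exists U0.
- by move=> _ [U [unU UW] <-]; rewrite pot0; case: (compare U unU UW).
move=> scvx U unU UW [_ minU].
have [_ /(_ scvx)] := compare U unU UW.
have : potential h (canonical_dual V W (U \o F)) <= \sum_k h (z k).
  by rewrite -pot0; apply: minU; exists U0.
move=> le /(_ le) [e onbe ortho].
have [_ [B [adjB BU UB]]] := unU.
have BUE v : B (U v) = v by rewrite -[LHS]/((B \o U) v) BU.
have UBE v : U (B v) = v by rewrite -[LHS]/((U \o B) v) UB.
have WB v : W v -> W (B v) by rewrite -{1}UW => -[v' Wv' <-]; rewrite BUE.
(* The common eigenbasis [e] provides the new principal vectors; its reversed pullback by the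
   inverse [B] of [U] provides the eigenvectors of the frame operator. *)
pose x' k := B (e (rev_ord k)).
have onbx' : orthonormal_basis W x'.
  split=> [i j|]; first by rewrite -(unitary_inner _ _ unU) !UBE onbe.1 (inj_eq rev_ord_inj).
  apply/seteqP; split=> [|v Wv].
    rewrite -onbe.2; apply: lspan_sub => k; rewrite onbe.2; apply: WB.
    exact: (onb_mem onbe).
  have : lspan (fun k => e (rev_ord k)) (U v).
    by rewrite (onb_perm onbe rev_ord_inj).2 -UW; exists v.
  move=> [c _ cE]; exists c => //; rewrite -[RHS]BUE -cE.
  by rewrite linear_fun_synthesis //; case: adjB.
exists e, x'; split=> //.
- apply/(principal_vectorsP PQ _ c0); split=> // k.
  (* [e k] has components only along those [w l] sharing its value of [a], hence its cosine. *)
  have a_inj l : cos (theta l) ^+ 2 != cos (theta k) ^+ 2 -> a l != a k.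
    by rewrite /a (inj_eq invr_inj).
  pose K := adjoint (orth_proj V \o orth_proj W) \o (orth_proj V \o orth_proj W).
  have KE : K = wop (fun k => (a k)^-1) w := gram_compression PQ onbw a0 gram.
  rewrite -[LHS]/(K (e k)) KE (wop_eigen (c := cos (theta k) ^+ 2) onbw) //.
    exact: (onb_mem onbe).
  by move=> l; rewrite invrK => /a_inj; case: (ortho k l).
- move=> j; rewrite frame_opF (wop_eigen (c := lam j) x_basis) //.
    exact: (onb_mem onbx').
  (* Applying [U] carries the components of [x' j] along [x l] to those of [e] along [y U], at
     reversed indices. *)
  move=> l lj; rewrite -(unitary_inner _ _ unU) UBE.
  have [_] := ortho (rev_ord j) (rev_ord l); rewrite /b /y !rev_ordK; apply.
  by rewrite (inj_eq invr_inj).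
- by move=> j; exact: UBE.
Qed.
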